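(* Let $u_h$ be the fine-grid semi-discrete solution, $u_H$ the semi-discrete multiscale interior penalty discontinuous Galerkin (IPDG) solution and $w_H$ the elliptic projection of $u_h$ (all defined in the context), and set $\eta=u_h-w_H$, $\xi=u_H-w_H$, $\varepsilon=u_h-u_H$. Then there is a constant $C>0$, independent of $h$, $H$ and of the functions $u_h,u_H,w_H$, such that $$\|\varepsilon_t\|_{L^\infty([0,T];L^2(\Omega))}+\|\varepsilon\|_{L^\infty([0,T];a)}\le C\Big(\|\eta_t\|_{L^\infty([0,T];L^2(\Omega))}+\|\eta\|_{L^\infty([0,T];H^1(\mathcal T^H))}+\|\eta_{tt}\|_{L^1([0,T];L^2(\Omega))}+\mathcal I_1\Big),$$ where $\mathcal I_1=\|\xi_t(0)\|_{L^2(\Omega)}+\|\xi(0)\|_{H^1(\mathcal T^H)}$.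
   Context: Meshes and coefficient. $\Omega\subset\mathbb R^2$ is a bounded domain partitioned by a fine mesh $\mathcal T^h$ of rectangles with maximum side length $h$. $\mathcal T^H$ is a coarse mesh of size $H$ whose blocks $K$ are connected unions of fine rectangles; $\mathcal E^H$ is the set of coarse edges. The coefficient $a(x)$ satisfies $a_0\le a(x)\le a_1$ for all $x\in\Omega$, with constants $a_0,a_1>0$. $(\cdot,\cdot)$ is the $L^2(\Omega)$ inner product. Fine-grid solution. $V_h$ is the space of continuous piecewise bilinear functions on $\mathcal T^h$ vanishing on $\partial\Omega$. $f(x,t)$ is a given source, $g_0,g_1$ are the given initial position and velocity, $T>0$. $u_h(t,\cdot)\in V_h$ satisfies $(\partial_t^2u_h,v)+\int_\Omega a\nabla u_h\cdot\nabla v=(f,v)$ for all $v\in V_h$. Multiscale space. For a coarse block $K$, $V_h(K)$ is the space of continuous piecewise bilinear functions on the fine rectangles of $K$, and $V_h^0(K)$ is the subspace of functions vanishing on $\partial K$. $V_H^1(K)$ is the $n$-dimensional space ($n$ = number of fine nodes on $\partial K$, depending on $K$) of $w\in V_h(K)$ with $\int_Ka\nabla w\cdot\nabla v=0$ for all $v\in V_h^0(K)$. Let $0=\mu_{1,K}<\mu_{2,K}\le\dots\le\mu_{n,K}$ and $\widetilde w_{i,K}\in V_H^1(K)$ be the eigenpairs of $\int_Ka\nabla w\cdot\nabla v=\frac{\mu}{H}\int_{\partial K}wv$ for all $v\in V_H^1(K)$, the $\widetilde w_{i,K}$ orthonormal in $L^2(\partial K)$. Let $\lambda_{1,K}\le\lambda_{2,K}\le\dots$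 and $z_{i,K}\in V_h^0(K)$ be the eigenpairs of $\int_Ka\nabla z\cdot\nabla v=\frac{\lambda}{H^2}\int_Kzv$ for all $v\in V_h^0(K)$, the $z_{i,K}$ orthonormal in $L^2(K)$. For chosen integers $p,m$ (possibly depending on $K$), $V_H$ is the space of functions on $\Omega$, in general discontinuous across coarse edges, whose restriction to each $K$ lies in $\mathrm{span}\{\widetilde w_{1,K},\dots,\widetilde w_{p,K},z_{1,K},\dots,z_{m,K}\}$. IPDG form. For an interior coarse edge $e$ shared by $K^+$ and $K^-$, with unit normal $n$ pointing from $K^+$ to $K^-$, $\{v\}_e=\frac12(v^++v^-)$ and $[v]_e=v^+-v^-$; for $e\subset\partial\Omega$, with $n$ the outward normal, $\{v\}_e=[v]_e=v$. With penalty parameter $\gamma>0$, $$a_{DG}(u,v)=\sum_{K\in\mathcal T^H}\int_Ka\nabla u\cdot\nabla v+\sum_{e\in\mathcal E^H}\Big(-\int_e\{a\nabla u\cdot n\}_e[v]_e-\int_e\{a\nabla v\cdot n\}_e[u]_e+\frac{\gamma}{h}\int_ea[u]_e[v]_e\Big).$$ $u_H(t,\cdot)\in V_H$ satisfies $(\partial_t^2u_H,v)+a_{DG}(u_H,v)=(f,v)$ for all $v\in V_H$, with $u_H(0)=P_H g_0$, $(u_H)_t(0)=P_Hg_1$, $P_H$ being the $L^2$-projection onto $V_H$. Norms. For $u$ piecewise $H^1$ on $\mathcal T^H$: $\|u\|_a^2=\sum_K\int_Ka|\nabla u|^2+\frac{\gamma}{h}\sum_{e\in\mathcal E^H}\|a^{1/2}[u]_e\|_{L^2(e)}^2$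 and $\|u\|_{H^1(\mathcal T^H)}^2=\sum_K|u|_{H^1(K)}^2+\frac{\gamma}{h}\sum_{e\in\mathcal E^H}\|[u]_e\|_{L^2(e)}^2$. For a space-time function, $\|\cdot\|_{L^\infty([0,T];X)}=\max_{0\le t\le T}\|\cdot\|_X$, with $X=a$ meaning the norm $\|\cdot\|_a$, and $\|\cdot\|_{L^1([0,T];X)}=\int_0^T\|\cdot\|_X\,dt$. Penalty parameter. $\gamma$ is taken sufficiently large that $\frac12\|v\|_a^2\le a_{DG}(v,v)$ and $a_{DG}(u,v)\le2\|u\|_a\|v\|_a$ for all $u,v\in V_H$. Elliptic projection. The consistency error is $R_{u_h}(v)=(f,v)-(\partial_t^2u_h,v)-a_{DG}(u_h,v)$ for $v\in V_H$. For each $t$, $w_H\in V_H$ is defined by $a_{DG}(w_H,v)=a_{DG}(u_h,v)+R_{u_h}(v)$ for all $v\in V_H$. The data are assumed smooth enough in time that all time derivatives written exist. *)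

(* Defs.v *)
From HB Require Import structures.
From mathcomp Require Import all_boot all_order all_algebra.
From mathcomp Require Import all_classical all_reals all_analysis.

Set Implicit Arguments.
Unset Strict Implicit.
Unset Printing Implicit Defensive.

Import Order.TTheory GRing.Theory Num.Theory numFieldNormedType.Exports.
Local Open Scope classical_set_scope.
Local Open Scope ring_scope.

Section Plane.
Context {R : realType}.

Definition mu2 := (@lebesgue_measure R \x @lebesgue_measure R)%E.

(* The last clause excludes slits: a domain lies locally on one side of its
   boundary, so that every boundary edge has exactly one adjacent block. *)
Definition is_domain (Omega : set (R * R)) : Prop :=
  [/\ open Omega, connected Omega, bounded_set Omega, Omega !=set0
    & Omega = interior (closure Omega)].

Definition bdry (A : set (R * R)) : set (R * R) := closure A `\` interior A.

(* Edge integrals involve a on the boundary of Omega, hence the closure.  On a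
   fine edge, a is evaluated pointwise. *)
Definition coefficient (Omega : set (R * R)) (a : R * R -> R) (a0 a1 : R) :
    Prop :=
  measurable_fun (closure Omega) a /\
  forall x, closure Omega x -> a0 <= a x <= a1.

Definition in_L2 (Omega : set (R * R)) (g : R * R -> R) : Prop :=
  measurable_fun Omega g /\
  mu2.-integrable Omega (fun x => (g x ^+ 2)%:E).

Definition dx (u : R * R -> R) (x : R * R) : R :=
  derive1 (fun s => u (s, x.2)) x.1.
Definition dy (u : R * R -> R) (x : R * R) : R :=
  derive1 (fun s => u (x.1, s)) x.2.

Definition gdot (u v : R * R -> R) (x : R * R) : R :=
  dx u x * dx v x + dy u x * dy v x.

(* One-sided directional derivative: the trace at an edge point x, taken from
   the side towards which d points, of the derivative of u along d. *)
Definition ddir (u : R * R -> R) (d x : R * R) : R :=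
  lim ((u (x + r *: d) - u x) / r @[r --> 0^'+]).

Definition bilinear_on (A : set (R * R)) (u : R * R -> R) : Prop :=
  exists c0 c1 c2 c3 : R, forall x, A x ->
    u x = c0 + c1 * x.1 + c2 * x.2 + c3 * (x.1 * x.2).

End Plane.

Section FineMesh.
Context {R : realType}.

Record fine_mesh := FineMesh {
  nrect : nat;
  lowc : 'I_nrect -> R * R;    (* lower left corner *)
  uppc : 'I_nrect -> R * R }.  (* upper right corner *)

(* Sides of a rectangle: (true, b) are the two vertical sides, (false, b) the
   two horizontal ones; b = true is the right (resp. top) one. *)
Definition side := (bool * bool)%type.

Definition normal (s : side) : R * R :=
  let c : R := if s.2 then 1 else -1 in if s.1 then (c, 0) else (0, c).

Context (fm : fine_mesh).
Implicit Types (i j : 'I_(nrect fm)) (s : side).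

Definition orect i : set (R * R) :=
  [set x | (lowc i).1 < x.1 < (uppc i).1 /\ (lowc i).2 < x.2 < (uppc i).2].

Definition crect i : set (R * R) :=
  [set x | (lowc i).1 <= x.1 <= (uppc i).1 /\
           (lowc i).2 <= x.2 <= (uppc i).2].

Definition side_point i s (r : R) : R * R :=
  if s.1 then (if s.2 then (uppc i).1 else (lowc i).1, r)
  else (r, if s.2 then (uppc i).2 else (lowc i).2).

Definition side_lo i s : R := if s.1 then (lowc i).2 else (lowc i).1.
Definition side_hi i s : R := if s.1 then (uppc i).2 else (uppc i).1.

Definition fside i s : set (R * R) :=
  side_point i s @` `[side_lo i s, side_hi i s].

Definition side_int i s (g : R * R -> R) : R :=
  \int[@lebesgue_measure R]_(r in `[side_lo i s, side_hi i s])
    g (side_point i s r).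

Definition vertices i : seq (R * R) :=
  [:: lowc i; uppc i; ((lowc i).1, (uppc i).2); ((uppc i).1, (lowc i).2)].

(* Conforming partition: two distinct closed rectangles are disjoint or meet
   exactly in a common vertex or in a common full side. *)
Definition is_fine_mesh (Omega : set (R * R)) : Prop :=
  [/\ forall i, (lowc i).1 < (uppc i).1 /\ (lowc i).2 < (uppc i).2,
      forall i j, i != j -> orect i `&` orect j = set0,
      closure Omega = \bigcup_(i in [set: 'I_(nrect fm)]) crect i
    & forall i j, i != j ->
        [\/ crect i `&` crect j = set0,
            exists P, [/\ P \in vertices i, P \in vertices j
                        & crect i `&` crect j = [set P]]
          | exists s s', crect i `&` crect j = fside i s /\
                         fside i s = fside j s']].

Definition fine_size (h : R) : Prop :=
  (forall i s, side_hi i s - side_lo i s <= h) /\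
  (exists i s, side_hi i s - side_lo i s = h).

End FineMesh.
Arguments fine_mesh : clear implicits.

Section CoarseMesh.
Context {R : realType} (fm : fine_mesh R).

Record coarse_mesh := CoarseMesh {
  nblk : nat;
  blk : 'I_(nrect fm) -> 'I_nblk }.  (* the block containing a rectangle *)

Context (cm : coarse_mesh).
Implicit Types (K : 'I_(nblk cm)).

Definition block K : set (R * R) :=
  \bigcup_(i in [set i | blk cm i = K]) crect i.

Definition is_coarse_mesh : Prop :=
  forall K, block K !=set0 /\ connected (block K).

Definition edist (x y : R * R) : R :=
  Num.sqrt ((x.1 - y.1) ^+ 2 + (x.2 - y.2) ^+ 2).

Definition coarse_size (H : R) : Prop :=
  (forall K x y, block K x -> block K y -> edist x y <= H) /\
  (exists K x y, [/\ block K x, block K y & edist x y = H]).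

(* Integrals over a block sum over its open fine rectangles: the gradients are
   only piecewise defined, and the fine edges are negligible. *)
Definition blk_int K (g : R * R -> R) : R :=
  \sum_(i < nrect fm | blk cm i == K) \int[mu2]_(x in orect i) g x.

Definition bdry_int K (g : R * R -> R) : R :=
  \sum_(i < nrect fm | blk cm i == K)
    \sum_(s : side | `[< fside i s `<=` bdry (block K) >]) side_int i s g.

Definition nodes K : seq (R * R) :=
  undup (flatten [seq vertices i | i <- enum 'I_(nrect fm) & blk cm i == K]).

Definition n_bdry_nodes K : nat :=
  count (fun P => `[< bdry (block K) P >]) (nodes K).

Definition n_int_nodes K : nat :=
  count (fun P => ~~ `[< bdry (block K) P >]) (nodes K).

Definition in_Vh (Omega : set (R * R)) (u : R * R -> R) : Prop :=
  [/\ {within closure Omega, continuous u},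
      forall i : 'I_(nrect fm), bilinear_on (crect i) u
    & forall x, (closure Omega `\` Omega) x -> u x = 0].

Definition in_VhK K (u : R * R -> R) : Prop :=
  {within block K, continuous u} /\
  forall i, blk cm i = K -> bilinear_on (crect i) u.

Definition in_VhK0 K (u : R * R -> R) : Prop :=
  in_VhK K u /\ forall x, bdry (block K) x -> u x = 0.

Definition in_VH1K (a : R * R -> R) K (w : R * R -> R) : Prop :=
  in_VhK K w /\
  forall v, in_VhK0 K v -> blk_int K (fun x => a x * gdot w v x) = 0.

(* Eigenpairs are numbered from 0; only the indices below n_bdry_nodes K (for
   smu, sw) and n_int_nodes K (for slam, sz) are meaningful. *)
Record spectral := Spectral {
  smu : 'I_(nblk cm) -> nat -> R;
  sw : 'I_(nblk cm) -> nat -> R * R -> R;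
  slam : 'I_(nblk cm) -> nat -> R;
  sz : 'I_(nblk cm) -> nat -> R * R -> R }.

Definition is_bdry_eigensystem (a : R * R -> R) (H : R) (sp : spectral) K :
    Prop :=
  let n := n_bdry_nodes K in
  [/\ forall i, (i < n)%N -> in_VH1K a K (sw sp K i) /\
        forall v, in_VH1K a K v ->
          blk_int K (fun x => a x * gdot (sw sp K i) v x) =
          smu sp K i / H * bdry_int K (fun x => sw sp K i x * v x),
      forall i j, (i < n)%N -> (j < n)%N ->
        bdry_int K (fun x => sw sp K i x * sw sp K j x) = (i == j)%:R,
      smu sp K 0%N = 0,
      forall i, (0 < i < n)%N -> 0 < smu sp K i
    & forall i j, (i <= j < n)%N -> smu sp K i <= smu sp K j].

Definition is_int_eigensystem (a : R * R -> R) (H : R) (sp : spectral) K :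
    Prop :=
  let n := n_int_nodes K in
  [/\ forall i, (i < n)%N -> in_VhK0 K (sz sp K i) /\
        forall v, in_VhK0 K v ->
          blk_int K (fun x => a x * gdot (sz sp K i) v x) =
          slam sp K i / H ^+ 2 * blk_int K (fun x => sz sp K i x * v x),
      forall i j, (i < n)%N -> (j < n)%N ->
        blk_int K (fun x => sz sp K i x * sz sp K j x) = (i == j)%:R
    & forall i j, (i <= j < n)%N -> slam sp K i <= slam sp K j].

Definition is_spectral (a : R * R -> R) (H : R) (sp : spectral) : Prop :=
  forall K, is_bdry_eigensystem a H sp K /\ is_int_eigensystem a H sp K.

(* A function on Omega that may be discontinuous across coarse edges: u K is
   the restriction to the closed block K; its values off K are irrelevant. *)
Definition bfun := 'I_(nblk cm) -> R * R -> R.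

Definition brk (u : R * R -> R) : bfun := fun=> u.

Definition in_VH (sp : spectral) (p m : 'I_(nblk cm) -> nat) (u : bfun) :
    Prop :=
  forall K, exists c d : nat -> R, forall x, block K x ->
    u K x = \sum_(i < p K) c i * sw sp K i x + \sum_(j < m K) d j * sz sp K j x.

Definition ip (u v : bfun) : R := \sum_K blk_int K (fun x => u K x * v K x).

Definition norm_L2 (u : bfun) : R := Num.sqrt (ip u u).

Definition energy (a : R * R -> R) (u v : bfun) : R :=
  \sum_K blk_int K (fun x => a x * gdot (u K) (v K) x).

Definition jump (u : bfun) (Kp : 'I_(nblk cm)) (Km : option 'I_(nblk cm))
    (x : R * R) : R :=
  if Km is Some K then u Kp x - u K x else u Kp x.

(* {a grad u . n}, with n pointing out of Kp: grad u^+ . n = - ddir (u Kp) (- n)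
   and grad u^- . n = ddir (u Km) n. *)
Definition avg_flux (a : R * R -> R) (u : bfun) (Kp : 'I_(nblk cm))
    (Km : option 'I_(nblk cm)) (n x : R * R) : R :=
  if Km is Some K then
    (a x * - ddir (u Kp) (- n) x + a x * ddir (u K) n x) / 2
  else a x * - ddir (u Kp) (- n) x.

Context (Omega : set (R * R)).

(* Sum over all coarse edges e of the integral over e of G K+ K- n.  The edges
   shared by two blocks are the fine sides common to both, with K+ the block of
   smaller index (all integrands used are independent of this choice); edges on
   the boundary of Omega have K- = None. *)
Definition skel_int
    (G : 'I_(nblk cm) -> option 'I_(nblk cm) -> R * R -> R * R -> R) : R :=
  \sum_(Kp < nblk cm) \sum_(Km < nblk cm | (Kp < Km)%N)
    \sum_(i < nrect fm | blk cm i == Kp)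
      \sum_(s : side | `[< exists j s', blk cm j = Km /\
                                        fside i s = fside j s' >])
        side_int i s (G Kp (Some Km) (normal s))
  + \sum_(K < nblk cm) \sum_(i < nrect fm | blk cm i == K)
      \sum_(s : side | `[< fside i s `<=` closure Omega `\` Omega >])
        side_int i s (G K None (normal s)).

Definition aDG (a : R * R -> R) (h gamma : R) (u v : bfun) : R :=
  energy a u v
  + (- skel_int (fun Kp Km n x => avg_flux a u Kp Km n x * jump v Kp Km x)
     - skel_int (fun Kp Km n x => avg_flux a v Kp Km n x * jump u Kp Km x)
     + gamma / h *
       skel_int (fun Kp Km _ x => a x * jump u Kp Km x * jump v Kp Km x)).

Definition norm_a (a : R * R -> R) (h gamma : R) (u : bfun) : R :=
  Num.sqrt (energy a u u +
    gamma / h * skel_int (fun Kp Km _ x => a x * jump u Kp Km x ^+ 2)).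

Definition norm_H1 (h gamma : R) (u : bfun) : R :=
  Num.sqrt (energy (cst 1) u u +
    gamma / h * skel_int (fun Kp Km _ x => jump u Kp Km x ^+ 2)).

Definition penalty_large (a : R * R -> R) (h gamma : R) (sp : spectral)
    (p m : 'I_(nblk cm) -> nat) : Prop :=
  (forall v, in_VH sp p m v ->
     1 / 2 * norm_a a h gamma v ^+ 2 <= aDG a h gamma v v) /\
  (forall u v, in_VH sp p m u -> in_VH sp p m v ->
     aDG a h gamma u v <= 2 * norm_a a h gamma u * norm_a a h gamma v).

(* Time derivative on [0, T], one-sided at 0 and T. *)
Definition diff_quot (u : R -> bfun) (t : R) (K : 'I_(nblk cm)) (x : R * R)
    (s : R) : R := (u s K x - u t K x) / (s - t).

Definition dt (T : R) (u : R -> bfun) : R -> bfun := fun t K x =>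
  lim (diff_quot u t K x s @[s --> within `[0, T] t^']).

Definition time_C2 (T : R) (u : R -> bfun) : Prop :=
  forall K x, block K x ->
  [/\ forall t, t \in `[0, T] ->
        cvg (diff_quot u t K x s @[s --> within `[0, T] t^']),
      forall t, t \in `[0, T] ->
        cvg (diff_quot (dt T u) t K x s @[s --> within `[0, T] t^'])
    & {within `[0, T], continuous (fun t => dt T (dt T u) t K x)}].

Definition norm_Linf (T : R) (N : bfun -> R) (u : R -> bfun) : \bar R :=
  ereal_sup [set (N (u t))%:E | t in `[0, T]].

Definition norm_L1 (T : R) (N : bfun -> R) (u : R -> bfun) : \bar R :=
  (\int[@lebesgue_measure R]_(t in `[0%R, T]) (N (u t))%:E)%E.

Definition is_fine_solution (a : R * R -> R) (T : R) (f : R -> R * R -> R)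
    (uh : R -> R * R -> R) : Prop :=
  forall t, t \in `[0, T] ->
    in_Vh Omega (uh t) /\
    forall v, in_Vh Omega v ->
      ip (dt T (dt T (fun s => brk (uh s))) t) (brk v)
      + energy a (brk (uh t)) (brk v) = ip (brk (f t)) (brk v).

Definition is_L2_proj (sp : spectral) (p m : 'I_(nblk cm) -> nat)
    (g : R * R -> R) (u : bfun) : Prop :=
  in_VH sp p m u /\ forall v, in_VH sp p m v -> ip u v = ip (brk g) v.

Definition is_IPDG_solution (a : R * R -> R) (h gamma T : R) (sp : spectral)
    (p m : 'I_(nblk cm) -> nat) (f : R -> R * R -> R) (g0 g1 : R * R -> R)
    (uH : R -> bfun) : Prop :=
  [/\ forall t, t \in `[0, T] ->
        in_VH sp p m (uH t) /\
        forall v, in_VH sp p m v ->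
          ip (dt T (dt T uH) t) v + aDG a h gamma (uH t) v = ip (brk (f t)) v,
      is_L2_proj sp p m g0 (uH 0)
    & is_L2_proj sp p m g1 (dt T uH 0)].

Definition consistency_error (a : R * R -> R) (h gamma T : R)
    (f : R -> R * R -> R) (uh : R -> R * R -> R) (t : R) (v : bfun) : R :=
  ip (brk (f t)) v - ip (dt T (dt T (fun s => brk (uh s))) t) v
  - aDG a h gamma (brk (uh t)) v.

Definition is_elliptic_proj (a : R * R -> R) (h gamma T : R) (sp : spectral)
    (p m : 'I_(nblk cm) -> nat) (f : R -> R * R -> R) (uh : R -> R * R -> R)
    (wH : R -> bfun) : Prop :=
  forall t, t \in `[0, T] ->
    in_VH sp p m (wH t) /\
    forall v, in_VH sp p m v ->
      aDG a h gamma (wH t) v =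
      aDG a h gamma (brk (uh t)) v + consistency_error a h gamma T f uh t v.

End CoarseMesh.
Arguments coarse_mesh {R} fm.
Arguments brk {R fm} cm u _ _.

(* Main.v *)
Require Import Defs.
From mathcomp Require Import all_boot all_order all_algebra.
From mathcomp Require Import all_classical all_reals all_analysis.
From mathcomp Require Import measurable_realfun.
From mathcomp Require Import ring lra.
Import Order.TTheory GRing.Theory Num.Theory numFieldNormedType.Exports.
Local Open Scope classical_set_scope.
Local Open Scope ring_scope.

Set Implicit Arguments.
Unset Strict Implicit.
Unset Printing Implicit Defensive.

(* Subtracting the elliptic projection from the multiscale solution, the
   consistency error and the source cancel, and xi = u_H - w_H satisfies
   (xi_tt, v) + a_DG(xi, v) = (eta_tt, v) on V_H.  With v = xi_t the energy
   E = |xi_t|^2 + a_DG(xi, xi) obeys E' = 2 (eta_tt, xi_t) <= 2 |eta_tt| sqrt E,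
   so that sqrt E <= sqrt (E 0) + 2 |eta_tt|_(L^1(L^2)); coercivity of a_DG and
   the triangle inequality for eps = eta - xi conclude.
   All the functions involved are bilinear on each fine rectangle, hence given
   by finitely many nodal values, in which every integral form is bilinear with
   constant coefficients.  Time regularity is thereby reduced to that of real
   functions of t. *)

(** * Integrals of forms with finitely many coordinates *)

(** Two gaps lie between the hypotheses and the formal argument. First, [dt] is a limit at a fixed
    point of a block, so differentiating an integral form in time requires a justification. It comes
    from interpolation: a pointwise limit of functions bilinear on a rectangle is bilinear there,
    and its corner values are the limits of the corner values. Second, [in_VH] supplies coefficients
    separately at each time, with no regularity in t, so the membership of xi_t in V_H is not at
    hand. It is never established: the error equation is tested with xi(s) for every s, and the
    resulting scalar identity is differentiated in s. Coercivity and continuity of a_DG are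
    available on V_H only and are applied to xi(t). The function eta leaves V_H; its energy norm is
    compared directly with the H^1 norm through a <= a1, which is how a1 enters the final
    constant. *)

Section BoundedMeasurable.
Context {d} {X : measurableType d} {R : realType} (D : set X).

(** Chosen instead of integrability because it is stable under products, while still giving
    integrability on sets of finite measure. *)
Definition bounded_measurable (f : X -> R) :=
  measurable_fun D f /\ exists C, forall x, D x -> `|f x| <= C.

Lemma bounded_measurable_cst (c : R) : bounded_measurable (fun=> c).
Proof. by split; [exact: measurable_cst | exists `|c|]. Qed.

Lemma bounded_measurableD (f g : X -> R) :
  bounded_measurable f -> bounded_measurable g ->
  bounded_measurable (fun x => f x + g x).
Proof.
move=> [mf [A fA]] [mg [B gB]]; split; first exact: measurable_funD.
exists (A + B) => x Dx.
by rewrite (le_trans (ler_normD _ _))// lerD// ?fA ?gB.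
Qed.

Lemma bounded_measurableM (f g : X -> R) :
  bounded_measurable f -> bounded_measurable g ->
  bounded_measurable (fun x => f x * g x).
Proof.
move=> [mf [A fA]] [mg [B gB]]; split; first exact: measurable_funM.
by exists (A * B) => x Dx; rewrite normrM ler_pM// ?fA ?gB.
Qed.

Lemma bounded_measurable_sum (I : Type) (r : seq I) (P : pred I)
    (f : I -> X -> R) :
  (forall i, bounded_measurable (f i)) ->
  bounded_measurable (fun x => \sum_(i <- r | P i) f i x).
Proof.
move=> bf; elim: r => [|i r IH].
  rewrite (_ : (fun _ => _) = fun=> 0); first exact: bounded_measurable_cst.
  by apply/funext => x; rewrite big_nil.
have [Pi|Pi] := boolP (P i); last first.
  by rewrite (_ : (fun _ => _) = fun x => \sum_(j <- r | P j) f j x)//;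
    apply/funext => x; rewrite big_cons (negbTE Pi).
rewrite (_ : (fun _ => _) = fun x => f i x + \sum_(j <- r | P j) f j x).
  exact: bounded_measurableD.
by apply/funext => x; rewrite big_cons Pi.
Qed.

Lemma bounded_measurable_integrable (mu : {measure set X -> \bar R})
    (f : X -> R) :
  measurable D -> (mu D < +oo)%E ->
  bounded_measurable f -> mu.-integrable D (EFin \o f).
Proof.
move=> mD muD [mf [C fC]]; apply: measurable_bounded_integrable => //.
exists C; split; first exact: num_real.
by move=> M CM x Dx; apply: le_trans (fC x Dx) (ltW CM).
Qed.

End BoundedMeasurable.

Section LocalForms.
Context {R : realType} {Y : Type} {J : finType}.
Context (P : Y -> Prop) (c : Y -> J -> R).

(* On P, the value of F at a point is a linear expression in the finitely many
   coordinates c y j, with bounded measurable coefficients. *)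
Definition local_form {d} {X : measurableType d} (D : set X)
    (F : Y -> X -> R) :=
  exists l : J -> X -> R, (forall j, bounded_measurable D (l j)) /\
  forall y, P y -> forall x, D x -> F y x = \sum_j l j x * c y j.

(** The coefficients [M] do not depend on [y]: once an integral has this form, a time-dependent [y]
    enters only through the finitely many numbers [c y j]. *)
Definition global_form (B : Y -> R) :=
  exists M : J -> R, forall y, P y -> B y = \sum_j M j * c y j.

Section OnDomain.
Context {d} {X : measurableType d} (D : set X).
Implicit Types F G : Y -> X -> R.

Lemma eq_local_form F G : (forall y, P y -> forall x, D x -> F y x = G y x) ->
  local_form D F -> local_form D G.
Proof.
by move=> FG [l [bl Fl]]; exists l; split=> // y Py x Dx; rewrite -FG// Fl.
Qed.

Lemma local_formD F G : local_form D F -> local_form D G ->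
  local_form D (fun y x => F y x + G y x).
Proof.
move=> [l [bl Fl]] [m [bm Gm]]; exists (fun j x => l j x + m j x); split=> [j|].
  exact: bounded_measurableD.
move=> y Py x Dx; rewrite Fl// Gm// -big_split; apply: eq_bigr => j _.
by rewrite mulrDl.
Qed.

Lemma local_formZ (w : X -> R) F : bounded_measurable D w -> local_form D F ->
  local_form D (fun y x => w x * F y x).
Proof.
move=> bw [l [bl Fl]]; exists (fun j x => w x * l j x); split=> [j|].
  exact: bounded_measurableM.
move=> y Py x Dx; rewrite Fl// mulr_sumr; apply: eq_bigr => j _.
by rewrite mulrA.
Qed.

Lemma local_formB F G : local_form D F -> local_form D G ->
  local_form D (fun y x => F y x - G y x).
Proof.
move=> lF lG; apply: (@eq_local_form (fun y x => F y x + -1 * G y x)).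
  by move=> y Py x Dx; rewrite mulN1r.
by apply: local_formD lF _; apply: local_formZ lG; exact: bounded_measurable_cst.
Qed.

Lemma local_form_integrable (mu : {measure set X -> \bar R}) F y :
  measurable D -> (mu D < +oo)%E -> local_form D F -> P y ->
  mu.-integrable D (EFin \o F y).
Proof.
move=> mD muD [l [bl Fl]] Py.
apply: (eq_integrable mD (EFin \o (fun x => \sum_j l j x * c y j))).
  by move=> x /set_mem Dx /=; rewrite Fl.
apply: bounded_measurable_integrable => //; apply: bounded_measurable_sum => j.
by apply: bounded_measurableM (bl j) _; exact: bounded_measurable_cst.
Qed.

Lemma global_form_integral (mu : {measure set X -> \bar R}) F :
  measurable D -> (mu D < +oo)%E -> local_form D F ->
  global_form (fun y => \int[mu]_(x in D) F y x).
Proof.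
move=> mD muD [l [bl Fl]]; exists (fun j => \int[mu]_(x in D) l j x) => y Py.
rewrite (eq_Rintegral _ _ (g := fun x => \sum_j l j x * c y j)); last first.
  by move=> x /set_mem Dx; rewrite Fl.
elim: (index_enum J) => [|j r IH].
  rewrite (eq_Rintegral _ _ (g := fun=> 0)) ?big_nil; last first.
    by move=> x _; rewrite big_nil.
  by rewrite Rintegral_cst// mul0r.
rewrite (eq_Rintegral _ _ (g := fun x => l j x * c y j +
  \sum_(j <- r) l j x * c y j)); last by move=> x _; rewrite big_cons.
have ib i : mu.-integrable D (EFin \o (fun x => l i x * c y i)).
  apply: bounded_measurable_integrable => //.
  by apply: bounded_measurableM (bl i) _; exact: bounded_measurable_cst.
rewrite RintegralD//.
  rewrite IH big_cons; congr (_ + _); rewrite RintegralZr//.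
  exact: bounded_measurable_integrable.
apply: bounded_measurable_integrable => //; apply: bounded_measurable_sum => i.
by apply: bounded_measurableM (bl i) _; exact: bounded_measurable_cst.
Qed.

End OnDomain.

Lemma eq_global_form (B B' : Y -> R) : (forall y, P y -> B y = B' y) ->
  global_form B -> global_form B'.
Proof. by move=> BB' [M BM]; exists M => y Py; rewrite -BB'// BM. Qed.

Lemma global_formD (B B' : Y -> R) : global_form B -> global_form B' ->
  global_form (fun y => B y + B' y).
Proof.
move=> [M BM] [M' BM']; exists (fun j => M j + M' j) => y Py.
by rewrite BM// BM'// -big_split; apply: eq_bigr => j _; rewrite mulrDl.
Qed.

Lemma global_formZ (k : R) (B : Y -> R) : global_form B ->
  global_form (fun y => k * B y).
Proof.
move=> [M BM]; exists (fun j => k * M j) => y Py.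
by rewrite BM// mulr_sumr; apply: eq_bigr => j _; rewrite mulrA.
Qed.

Lemma global_form_sum (I : Type) (r : seq I) (Q : pred I) (B : I -> Y -> R) :
  (forall i, Q i -> global_form (B i)) ->
  global_form (fun y => \sum_(i <- r | Q i) B i y).
Proof.
move=> gB; elim: r => [|i r IH].
  exists (fun=> 0) => y _; rewrite big_nil big1// => j _; exact: mul0r.
have [Qi|Qi] := boolP (Q i); last first.
  by apply: eq_global_form IH => y _; rewrite big_cons (negbTE Qi).
apply: (@eq_global_form (fun y => B i y + \sum_(j <- r | Q j) B j y)).
  by move=> y _; rewrite big_cons Qi.
exact: global_formD (gB i Qi) IH.
Qed.

End LocalForms.

Section BilinearForms.
Context {R : realType} {Y : Type} {J : finType}.
Context (P : Y -> Prop) (c : Y -> J -> R).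

(** A bilinear form is encoded as a linear form on pairs whose coordinates are the products of the
    coordinates of the two entries, so that the results on linear forms apply to it unchanged. *)
Definition pair_prop (y : Y * Y) := P y.1 /\ P y.2.
Definition pair_coord (y : Y * Y) (j : J * J) := c y.1 j.1 * c y.2 j.2.

Lemma local_formM {d} {X : measurableType d} (D : set X) (F G : Y -> X -> R) :
  local_form P c D F -> local_form P c D G ->
  local_form pair_prop pair_coord D (fun y x => F y.1 x * G y.2 x).
Proof.
move=> [l [bl Fl]] [m [bm Gm]]; exists (fun j x => l j.1 x * m j.2 x).
split=> [j|[y z] [/= Py Pz] x Dx]; first exact: bounded_measurableM.
rewrite Fl// Gm// big_distrlr pair_bigA /=; apply: eq_bigr => j _.
by rewrite mulrACA.
Qed.

End BilinearForms.

(** * Piecewise bilinear functions *)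

Lemma bilinear_sum {R : realType} (A : set (R * R)) (I : Type) (r : seq I) (Q : pred I)
    (c : I -> R) (w : I -> R * R -> R) :
  (forall i, Q i -> bilinear_on A (w i)) ->
  bilinear_on A (fun x => \sum_(i <- r | Q i) c i * w i x).
Proof.
move=> bw; elim: r => [|i r [c0 [c1 [c2 [c3 IH]]]]].
  by exists 0, 0, 0, 0 => x _; rewrite big_nil; ring.
have [Qi|Qi] := boolP (Q i); last first.
  by exists c0, c1, c2, c3 => x Ax; rewrite big_cons (negbTE Qi) IH.
have [d0 [d1 [d2 [d3 wE]]]] := bw i Qi.
exists (c i * d0 + c0), (c i * d1 + c1), (c i * d2 + c2), (c i * d3 + c3).
by move=> x Ax; rewrite big_cons Qi IH// wE//; ring.
Qed.

Section NodalValues.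
Context {R : realType} {fm : fine_mesh R} {cm : coarse_mesh fm}.
Context (nondeg : forall i : 'I_(nrect fm),
  (lowc i).1 < (uppc i).1 /\ (lowc i).2 < (uppc i).2).
Implicit Types (i j : 'I_(nrect fm)) (u v : bfun cm).

Definition vertex i (b : bool * bool) : R * R :=
  (if b.1 then (uppc i).1 else (lowc i).1,
   if b.2 then (uppc i).2 else (lowc i).2).

(** Indexed by rectangle and corner, so a mesh node is counted once per adjacent rectangle. No
    identification of nodes is made, and jumps across coarse edges need no special treatment. *)
Definition nodal u (k : 'I_(nrect fm) * (bool * bool)) : R :=
  u (blk cm k.1) (vertex k.1 k.2).

Definition piecewise_bilinear u :=
  forall i, bilinear_on (crect i) (u (blk cm i)).

(** The affine Lagrange functions of an interval: [b = true] is the one with value 1 at [hi]. *)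
Definition hat1 (lo hi : R) (b : bool) (s : R) : R :=
  (if b then s - lo else hi - s) / (hi - lo).

Definition hat i (b : bool * bool) x : R :=
  hat1 (lowc i).1 (uppc i).1 b.1 x.1 * hat1 (lowc i).2 (uppc i).2 b.2 x.2.

Lemma crect_vertex i b : crect i (vertex i b).
Proof.
by case: (nondeg i) b => /ltW le1 /ltW le2 [[] []]; split; rewrite /= ?lexx ?le1 ?le2.
Qed.

Lemma crect_block i x : crect i x -> block (blk cm i) x.
Proof. by move=> ix; exists i. Qed.

Lemma bilinear_interpolation i (w : R * R -> R) x :
  bilinear_on (crect i) w -> crect i x ->
  w x = \sum_b hat i b x * w (vertex i b).
Proof.
move=> [c0 [c1 [c2 [c3 wE]]]] ix.
rewrite wE// (eq_bigr (fun b => hat i b x * (c0 + c1 * (vertex i b).1 +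
  c2 * (vertex i b).2 + c3 * ((vertex i b).1 * (vertex i b).2)))); last first.
  by move=> b _; rewrite wE//; exact: crect_vertex.
have [/lt0r_neq0 n1 /lt0r_neq0 n2] : 0 < (uppc i).1 - (lowc i).1 /\
    0 < (uppc i).2 - (lowc i).2.
  by rewrite !subr_gt0.
rewrite -(pair_bigA _ (fun b1 b2 => hat i (b1, b2) x * (c0 +
  c1 * (vertex i (b1, b2)).1 + c2 * (vertex i (b1, b2)).2 +
  c3 * ((vertex i (b1, b2)).1 * (vertex i (b1, b2)).2))))/=.
by rewrite !big_bool/= /hat /hat1/=; field; rewrite n1 n2.
Qed.

Lemma hat1_bound (lo hi : R) b (s : R) : lo < hi -> lo <= s <= hi ->
  `|hat1 lo hi b s| <= 1.
Proof.
move=> lohi /andP[los shi].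
rewrite normrM normfV (gtr0_norm (_ : 0 < hi - lo)) ?subr_gt0//.
rewrite ler_pdivrMr ?subr_gt0// mul1r.
by case: b; rewrite ger0_norm ?subr_ge0// lerB.
Qed.

Section OnDomain.
Context {d} {X : measurableType d} (D : set X).

Lemma bounded_measurable_hat1 (lo hi : R) b (phi : X -> R) : lo < hi ->
  measurable_fun D phi -> (forall x, D x -> lo <= phi x <= hi) ->
  bounded_measurable D (fun x => hat1 lo hi b (phi x)).
Proof.
move=> lohi mphi Dphi; split; last first.
  by exists 1 => x Dx; apply: hat1_bound => //; exact: Dphi.
apply: (@measurable_funM _ _ _ D _ (cst (hi - lo)^-1)) => //.
case: b; first exact: (@measurable_funB _ _ _ D _ (cst lo)).
exact: (@measurable_funB _ _ _ D (cst hi)).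
Qed.

(** The map [phi] lets one statement serve for values inside a rectangle, for values projected onto
    a side (needed by slopes) and for traces along a side. *)
Lemma local_form_eval i (phi : X -> R * R) :
  measurable_fun D (fst \o phi) -> measurable_fun D (snd \o phi) ->
  (forall x, D x -> crect i (phi x)) ->
  local_form piecewise_bilinear nodal D (fun u x => u (blk cm i) (phi x)).
Proof.
move=> m1 m2 Dphi.
(* Only the four corners of rectangle [i] carry a nonzero coefficient. *)
exists (fun k x => (k.1 == i)%:R * hat i k.2 (phi x)); split=> [[k b]|].
  apply: bounded_measurableM; first exact: bounded_measurable_cst.
  have [lt1 lt2] := nondeg i.
  by apply: bounded_measurableM; apply: bounded_measurable_hat1 => // x;
    case/Dphi.
move=> u bu x Dx; rewrite (bilinear_interpolation (bu i) (Dphi x Dx)).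
rewrite -(pair_bigA _ (fun k b => (k == i)%:R * hat i b (phi x) * nodal u (k, b)))/=.
rewrite (bigD1 i)//= [X in _ = _ + X]big1 ?addr0; last first.
  by move=> k /negbTE ki; apply: big1 => b _; rewrite ki !mul0r.
by apply: eq_bigr => b _; rewrite eqxx mul1r.
Qed.

End OnDomain.

Lemma piecewise_bilinear_comb (k : R) u v :
  piecewise_bilinear u -> piecewise_bilinear v ->
  piecewise_bilinear (fun K x => u K x + k * v K x).
Proof.
move=> bu bv i.
have [c0 [c1 [c2 [c3 uE]]]] := bu i; have [d0 [d1 [d2 [d3 vE]]]] := bv i.
exists (c0 + k * d0), (c1 + k * d1), (c2 + k * d2), (c3 + k * d3) => x ix.
by rewrite uE// vE//; ring.
Qed.

Lemma piecewise_bilinearB u v :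
  piecewise_bilinear u -> piecewise_bilinear v ->
  piecewise_bilinear (fun K x => u K x - v K x).
Proof.
move=> bu bv i.
have [c0 [c1 [c2 [c3 uE]]]] := bu i; have [d0 [d1 [d2 [d3 vE]]]] := bv i.
exists (c0 - d0), (c1 - d1), (c2 - d2), (c3 - d3) => x ix.
by rewrite uE// vE//; ring.
Qed.

Lemma derive1_near_affine (w : R -> R) (c0 c1 s : R) :
  (\forall r \near s, w r = c0 + c1 * r) -> derive1 w s = c1.
Proof.
move=> nw; rewrite derive1E (near_eq_derive _ nw).
have : is_derive s 1 (fun r : R => c0 + c1 * r) (0 + c1 *: 1).
  apply: is_deriveD; exact: is_deriveZ.
by move=> H; rewrite derive_val add0r /GRing.scale/= mulr1.
Qed.

(* The derivatives of a bilinear function along the axes are slopes between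
   points of opposite sides, hence combinations of point values. *)
Lemma dx_bilinear i (w : R * R -> R) x :
  bilinear_on (crect i) w -> orect i x ->
  dx w x = ((uppc i).1 - (lowc i).1)^-1 *
    (w ((uppc i).1, x.2) - w ((lowc i).1, x.2)).
Proof.
move=> [c0 [c1 [c2 [c3 wE]]]] [/= x1 /andP[/ltW l2 /ltW u2]].
have [lt1 _] := nondeg i; have le1 := ltW lt1.
have d1 : (uppc i).1 - (lowc i).1 != 0 by rewrite lt0r_neq0// subr_gt0.
rewrite /dx (@derive1_near_affine _ (c0 + c2 * x.2) (c1 + c3 * x.2)).
  rewrite !wE/=; first by field.
    by split; rewrite /= ?lexx ?le1 ?l2.
  by split; rewrite /= ?lexx ?le1 ?l2.
have xi : x.1 \in `](lowc i).1, (uppc i).1[ by rewrite in_itv.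
apply: filterS (near_in_itvoo xi) => r /=; rewrite in_itv/=.
move=> /andP[/ltW lr /ltW ru]; rewrite wE/=; first by ring.
by split; rewrite /= ?lr ?l2.
Qed.

Lemma dy_bilinear i (w : R * R -> R) x :
  bilinear_on (crect i) w -> orect i x ->
  dy w x = ((uppc i).2 - (lowc i).2)^-1 *
    (w (x.1, (uppc i).2) - w (x.1, (lowc i).2)).
Proof.
move=> [c0 [c1 [c2 [c3 wE]]]] [/= /andP[/ltW l1 /ltW u1] x2].
have [_ lt2] := nondeg i; have le2 := ltW lt2.
have d2 : (uppc i).2 - (lowc i).2 != 0 by rewrite lt0r_neq0// subr_gt0.
rewrite /dy (@derive1_near_affine _ (c0 + c1 * x.1) (c2 + c3 * x.1)).
  rewrite !wE/=; first by field.
    by split; rewrite /= ?lexx ?le2 ?l1.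
  by split; rewrite /= ?lexx ?le2 ?l1.
have xi : x.2 \in `](lowc i).2, (uppc i).2[ by rewrite in_itv.
apply: filterS (near_in_itvoo xi) => r /=; rewrite in_itv/=.
move=> /andP[/ltW lr /ltW ru]; rewrite wE/=; first by ring.
by split; rewrite /= ?lr ?l1.
Qed.

(** The extent of the rectangle across [s], not the length of [s]. *)
Definition side_width i (s : side) : R :=
  if s.1 then (uppc i).1 - (lowc i).1 else (uppc i).2 - (lowc i).2.

Lemma side_width_gt0 i s : 0 < side_width i s.
Proof.
by have [lt1 lt2] := nondeg i; rewrite /side_width; case: ifP; rewrite subr_gt0.
Qed.

Lemma crect_side_point i s r : side_lo i s <= r <= side_hi i s ->
  crect i (side_point i s r).
Proof.
have [/ltW le1 /ltW le2] := nondeg i.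
by case: s => [[] []] /= rs; split; rewrite /= ?lexx ?le1 ?le2.
Qed.

(** A bilinear function is affine along the axes, so the difference quotient is constant for steps
    up to the width of the rectangle and equals the slope towards the opposite side
    [(s.1, ~~ s.2)]. *)
Lemma ddir_inward i s (w : R * R -> R) r :
  bilinear_on (crect i) w -> side_lo i s <= r <= side_hi i s ->
  ddir w (- normal s) (side_point i s r) =
  (side_width i s)^-1 *
    (w (side_point i (s.1, ~~ s.2) r) - w (side_point i s r)).
Proof.
move=> [c0 [c1 [c2 [c3 wE]]]] rs; have wd := side_width_gt0 i s.
have ro : side_lo i (s.1, ~~ s.2) <= r <= side_hi i (s.1, ~~ s.2).
  by case: s rs {wd} => [[] []].
rewrite /ddir; apply: cvg_lim => //.
apply: (@cvg_near_cst _ _ _ _ _ _).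
near=> e.
have e0 : 0 < e by near: e; exact: nbhs_right_gt.
have ew : e <= side_width i s by near: e; exact: nbhs_right_le.
have scE (b : R) : e *: b = e * b by [].
have ie : crect i (side_point i s r + e *: - normal s).
  have [/ltW le1 /ltW le2] := nondeg i.
  move: rs ew; rewrite /side_point /side_lo /side_hi /side_width /normal.
  by case: (s) => [[] []] /= /andP[r1 r2] ew; split;
    rewrite /= !scE;
    apply/andP; split; lra.
have we := lt0r_neq0 wd; have {}e0 := lt0r_neq0 e0.
rewrite !wE//; [|exact: crect_side_point..].
case: (s) (we) => [[] []]; rewrite /side_width/= => {}we; rewrite /= !scE;
  field; by rewrite ?we ?e0.
Unshelve. all: by end_near.
Qed.

End NodalValues.

(** * Geometry of fine sides shared by two rectangles *)

Section Skeleton.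
Context {R : realType} {fm : fine_mesh R}.
Context (nondeg : forall i : 'I_(nrect fm),
  (lowc i).1 < (uppc i).1 /\ (lowc i).2 < (uppc i).2).
Implicit Types (i j : 'I_(nrect fm)) (s : side).

Lemma side_lo_lt_hi i s : side_lo i s < side_hi i s.
Proof. by have [lt1 lt2] := nondeg i; case: s => [[] []]. Qed.

(* Two rectangles on the same side of a common edge would overlap near it. *)
Lemma shared_side i j s s' :
  orect i `&` orect j = set0 -> fside i s `<=` fside j s' ->
  s' = (s.1, ~~ s.2) /\
  forall r, side_lo i s <= r <= side_hi i s ->
    side_lo j s' <= r <= side_hi j s' /\ side_point i s r = side_point j s' r.
Proof.
move=> dij sub.
have P r : side_lo i s <= r <= side_hi i s ->
    exists2 q, side_lo j s' <= q <= side_hi j s' &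
      side_point j s' q = side_point i s r.
  move=> rs; have [|q /=] := sub (side_point i s r).
    by exists r; rewrite //= in_itv.
  by rewrite in_itv/= => qs <-; exists q.
have lohi := side_lo_lt_hi i s.
have [q1 h1 e1] := P (side_lo i s) ltac:(by rewrite lexx ltW).
have [q2 h2 e2] := P (side_hi i s) ltac:(by rewrite lexx ltW).
(* A depth smaller than all four side lengths: the point at depth [m] behind the midpoint of the
   shared side then lies in every open rectangle situated on that side of it. *)
have [m m0 [[m1 m2] [m3 m4]]] : exists2 m : R, 0 < m &
   (m < (uppc i).1 - (lowc i).1 /\ m < (uppc i).2 - (lowc i).2) /\
   (m < (uppc j).1 - (lowc j).1 /\ m < (uppc j).2 - (lowc j).2).
  have [a1 a2] := nondeg i; have [b1 b2] := nondeg j.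
  set m := Num.min (Num.min ((uppc i).1 - (lowc i).1) ((uppc i).2 - (lowc i).2))
    (Num.min ((uppc j).1 - (lowc j).1) ((uppc j).2 - (lowc j).2)).
  have m0 : 0 < m by rewrite !lt_min !subr_gt0 a1 a2 b1 b2.
  have : m / 2 < m by lra.
  by exists (m / 2); [lra | rewrite !lt_min in H *; case/andP: H => /andP[? ?] /andP[]].
have no x : orect i x -> orect j x -> False.
  by move=> ix jx; have : set0 x by rewrite -dij.
clear dij.
rewrite /side_lo /side_hi /side_point in P lohi h1 e1 h2 e2 *.
case: s s' P lohi h1 e1 h2 e2 {sub} => [[] []] [[] []] /= P lohi
  /andP[h1 h1'] [e1 f1] /andP[h2 h2'] [e2 f2].
(* A vertical and a horizontal side are incompatible, since the two end points of the side of [i]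
   would have to coincide. Opposite sides give the conclusion; the four cases of equal sides remain
   and yield a common interior point. *)
all: try by exfalso; lra.
all: try by split=> // r /P[q qs [<- <-]].
- by exfalso; apply: (no ((uppc i).1 - m, ((lowc i).2 + (uppc i).2) / 2));
    split => /=; apply/andP; split; lra.
- by exfalso; apply: (no ((lowc i).1 + m, ((lowc i).2 + (uppc i).2) / 2));
    split => /=; apply/andP; split; lra.
- by exfalso; apply: (no (((lowc i).1 + (uppc i).1) / 2, (uppc i).2 - m));
    split => /=; apply/andP; split; lra.
- by exfalso; apply: (no (((lowc i).1 + (uppc i).1) / 2, (lowc i).2 + m));
    split => /=; apply/andP; split; lra.
Qed.

End Skeleton.

(** * Measurability and finiteness of measure on the mesh *)

Section MeasurableMesh.
Context {R : realType} {fm : fine_mesh R} (Omega : set (R * R)).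
Implicit Types (i j : 'I_(nrect fm)) (s : side).
Let plane := (measurableTypeR R * measurableTypeR R)%type.

Lemma orectE i : orect i =
  [set` `](lowc i).1, (uppc i).1[] `*` [set` `](lowc i).2, (uppc i).2[].
Proof.
by apply/seteqP; split=> x; rewrite /orect/= !in_itv/=.
Qed.

Lemma measurable_orect i : measurable (orect i : set plane).
Proof. by rewrite orectE; apply: measurableX; exact: measurable_itv. Qed.

Lemma measurable_crect i : measurable (crect i : set plane).
Proof.
rewrite (_ : crect i = [set` `[(lowc i).1, (uppc i).1]] `*`
  [set` `[(lowc i).2, (uppc i).2]]).
  by apply: measurableX; exact: measurable_itv.
by apply/seteqP; split=> x; rewrite /crect/= !in_itv/=.
Qed.

Lemma lebesgue_bounded_itv_lty (b b' : bool) (r t : R) :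
  (lebesgue_measure [set` Interval (BSide b r) (BSide b' t)] < +oo)%E.
Proof.
by rewrite lebesgue_measure_itv/=; case: ifP => _; rewrite -?EFinB ltry.
Qed.

Lemma mu2_orect_lty i : (mu2 (orect i) < +oo)%E.
Proof.
rewrite orectE /mu2 product_measure1E; [|exact: measurable_itv..].
apply: lte_mul_pinfty => //; last exact: lebesgue_bounded_itv_lty.
by rewrite ge0_fin_numE//; exact: lebesgue_bounded_itv_lty.
Qed.

Context (a : R * R -> R) (a0 a1 : R).
Context (coverE : closure Omega = \bigcup_(i in [set: 'I_(nrect fm)]) crect i).
Context (ha : coefficient Omega a a0 a1).

Lemma orect_crect i : orect i `<=` crect i.
Proof. by move=> x [/andP[/ltW p /ltW q] /andP[/ltW p' /ltW q']]; split; apply/andP. Qed.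

Lemma crect_closure i : crect i `<=` closure Omega.
Proof. by move=> x ix; rewrite coverE; exists i. Qed.

Lemma measurable_closure : measurable (closure Omega : set plane).
Proof.
rewrite coverE; apply: fin_bigcup_measurable => [|i _]; first exact: finite_finset.
exact: measurable_crect.
Qed.

Lemma coefficient_abs x : closure Omega x -> `|a x| <= `|a0| + `|a1|.
Proof.
move=> /(proj2 ha) /andP[ax xa]; rewrite ler_norml.
by apply/andP; split; move: (ler_norm a1) (ler_norm (- a0)) (normr_ge0 a0)
  (normr_ge0 a1); rewrite normrN; lra.
Qed.

Lemma bounded_measurable_coefficient i :
  @bounded_measurable _ plane R (orect i) a.
Proof.
split; last first.
  exists (`|a0| + `|a1|) => x /orect_crect /crect_closure; exact: coefficient_abs.
apply: (@measurable_funS _ _ _ _ (closure Omega : set plane)).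
- exact: measurable_closure.
- by move=> x /orect_crect /crect_closure.
- exact: (proj1 ha).
Qed.

Lemma measurable_side_point i s :
  measurable_fun [set: measurableTypeR R] (side_point i s : _ -> plane).
Proof.
by case: s => [[] []]; apply: measurable_fun_pair; try exact: measurable_id;
  exact: measurable_cst.
Qed.

(** A side is a null set of the plane, but [a] is a measurable function defined at every point of
    [closure Omega], so composing it with the measurable parametrisation of the side is
    meaningful. *)
Lemma bounded_measurable_coefficient_side i s
    (nondeg : forall i, (lowc i).1 < (uppc i).1 /\ (lowc i).2 < (uppc i).2) :
  @bounded_measurable _ (measurableTypeR R) R
    [set` `[side_lo i s, side_hi i s]] (fun r => a (side_point i s r)).
Proof.
have cl r : `[side_lo i s, side_hi i s]%classic r -> closure Omega (side_point i s r).
  by rewrite /= in_itv/= => rs; apply/(@crect_closure i)/crect_side_point.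
split; last by exists (`|a0| + `|a1|) => r /cl; exact: coefficient_abs.
apply: (@measurable_comp _ _ _ _ _ _ (closure Omega : set plane)).
- exact: measurable_closure.
- by move=> _ [r rs <-]; exact: cl.
- exact: (proj1 ha).
- exact: measurable_funTS (measurable_side_point i s).
Qed.

End MeasurableMesh.

(** * Discrete forms as forms in the nodal values *)

Section DiscreteForms.
Context {R : realType} {fm : fine_mesh R} {cm : coarse_mesh fm}.
Context (Omega : set (R * R)) (a : R * R -> R) (a0 a1 : R).
Context (meshP : is_fine_mesh fm Omega) (ha : coefficient Omega a a0 a1).
Implicit Types (i j : 'I_(nrect fm)) (s : side) (u v : bfun cm).
Implicit Types (Km : option 'I_(nblk cm)).
Let plane := (measurableTypeR R * measurableTypeR R)%type.

Let nondeg i : (lowc i).1 < (uppc i).1 /\ (lowc i).2 < (uppc i).2.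
Proof. by case: meshP. Qed.

Let coverE : closure Omega = \bigcup_(i in [set: 'I_(nrect fm)]) crect i.
Proof. by case: meshP. Qed.

Local Notation local D F :=
  (local_form (@piecewise_bilinear R fm cm) (@nodal R fm cm) D F).
Local Notation side_dom i s :=
  ([set` `[side_lo i s, side_hi i s]] : set (measurableTypeR R)).

Definition nodal_bilinear (B : bfun cm -> bfun cm -> R) :=
  global_form (pair_prop (@piecewise_bilinear R fm cm))
    (pair_coord (@nodal R fm cm)) (fun y => B y.1 y.2).

(* s is a fine side of the rectangle i lying on the coarse edge that separates
   its block from Km, or from the outside when Km is None. *)
Definition coarse_side i Km s : Prop :=
  if Km is Some K then
    blk cm i <> K /\ exists j s', blk cm j = K /\ fside i s = fside j s'
  else fside i s `<=` closure Omega `\` Omega.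

Lemma local_value i :
  local (orect i : set plane) (fun u x => u (blk cm i) x).
Proof.
apply: local_form_eval => //; first exact: measurable_funTS measurable_fst.
- exact: measurable_funTS measurable_snd.
- exact: orect_crect.
Qed.

Lemma local_dx i : local (orect i : set plane) (fun u x => dx (u (blk cm i)) x).
Proof.
have le1 : (lowc i).1 <= (uppc i).1 by rewrite ltW//; case: (nondeg i).
apply: eq_local_form.
  by move=> u bu x ix; apply/esym; exact: (dx_bilinear nondeg (bu i) ix).
apply: local_formZ; first exact: bounded_measurable_cst.
apply: local_formB; apply: (local_form_eval nondeg (phi := fun x => (_, x.2)));
  do ?[exact: measurable_cst | exact: measurable_funTS measurable_snd];
  by move=> x /orect_crect[_ x2]; split; rewrite /= ?lexx ?le1.
Qed.

Lemma local_dy i : local (orect i : set plane) (fun u x => dy (u (blk cm i)) x).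
Proof.
have le2 : (lowc i).2 <= (uppc i).2 by rewrite ltW//; case: (nondeg i).
apply: eq_local_form.
  by move=> u bu x ix; apply/esym; exact: (dy_bilinear nondeg (bu i) ix).
apply: local_formZ; first exact: bounded_measurable_cst.
apply: local_formB; apply: (local_form_eval nondeg (phi := fun x => (x.1, _)));
  do ?[exact: measurable_cst | exact: measurable_funTS measurable_fst];
  by move=> x /orect_crect[x1 _]; split; rewrite /= ?lexx ?le2.
Qed.

(** [D] is left free because the trace from a neighbouring rectangle is integrated over the
    parameter interval of the other rectangle. *)
Lemma local_trace (D : set (measurableTypeR R)) j s :
  (forall r, D r -> side_lo j s <= r <= side_hi j s) ->
  local D (fun u r => u (blk cm j) (side_point j s r)).
Proof.
move=> sub; apply: local_form_eval => // [||r /sub].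
- apply: measurable_funTS; apply: measurableT_comp (measurable_side_point j s).
  exact: measurable_fst.
- apply: measurable_funTS; apply: measurableT_comp (measurable_side_point j s).
  exact: measurable_snd.
- exact: crect_side_point.
Qed.

Lemma local_ddir (D : set (measurableTypeR R)) j s :
  (forall r, D r -> side_lo j s <= r <= side_hi j s) ->
  local D (fun u r => ddir (u (blk cm j)) (- normal s) (side_point j s r)).
Proof.
move=> sub; apply: eq_local_form.
  by move=> u bu r /sub Dr; apply/esym; exact: (ddir_inward nondeg (bu j) Dr).
apply: local_formZ; first exact: bounded_measurable_cst.
apply: local_formB; last exact: local_trace.
by apply: local_trace => r /sub; case: s {sub} => [[] []].
Qed.

(** Rectangles of different blocks are distinct, hence have disjoint interiors, and [shared_side]
    applies. Traces from both blocks can then be written in a single parameter. *)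
Lemma coarse_sideE i K s : coarse_side i (Some K) s ->
  exists j s', [/\ blk cm j = K, normal s = - normal s' :> R * R &
    forall r, side_lo i s <= r <= side_hi i s ->
      side_lo j s' <= r <= side_hi j s' /\ side_point i s r = side_point j s' r].
Proof.
move=> [iK [j [s' [jK ss']]]]; exists j, s'.
have ij : i != j by apply/eqP => ij; apply: iK; rewrite ij.
have dij : orect i `&` orect j = set0 by case: meshP => _ + _ _; exact.
have [] := shared_side nondeg dij (s := s) (s' := s'); first by rewrite ss'.
move=> s'E sP; split=> //; rewrite s'E.
by case: s {ss' s'E sP} => [[] []]; rewrite /normal/=; congr pair;
  rewrite /= ?oppr0 ?opprK.
Qed.

Lemma local_jump i Km s : coarse_side i Km s ->
  local (side_dom i s) (fun u r => jump u (blk cm i) Km (side_point i s r)).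
Proof.
have tr : local (side_dom i s) (fun u r => u (blk cm i) (side_point i s r)).
  by apply: local_trace => r; rewrite /= in_itv.
case: Km => [K|] //= /coarse_sideE[j [s' [<- _ sP]]].
apply: local_formB => //.
apply: (@eq_local_form _ _ _ _ _ _ _ _
  (fun u r => u (blk cm j) (side_point j s' r))).
  by move=> u _ r; rewrite /= in_itv/= => /sP[_ ->].
by apply: local_trace => r; rewrite /= in_itv/= => /sP[].
Qed.

(** The derivative taken inside the neighbour along [normal s] is again an inward derivative,
    because [normal s] is opposite to the neighbour's own normal. *)
Lemma local_avg_flux i Km s : coarse_side i Km s ->
  local (side_dom i s)
    (fun u r => avg_flux a u (blk cm i) Km (normal s) (side_point i s r)).
Proof.
have ba := bounded_measurable_coefficient_side coverE ha i s nondeg.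
have inner : local (side_dom i s) (fun u r => a (side_point i s r) *
    - ddir (u (blk cm i)) (- normal s) (side_point i s r)).
  apply: (@eq_local_form _ _ _ _ _ _ _ _ (fun u r => -1 *
    (a (side_point i s r) * ddir (u (blk cm i)) (- normal s) (side_point i s r)))).
    by move=> u _ r _; rewrite mulN1r mulrN.
  apply: local_formZ; first exact: bounded_measurable_cst.
  apply: local_formZ => //.
  by apply: local_ddir => r; rewrite /= in_itv.
case: Km => [K|] //= /coarse_sideE[j [s' [<- nE sP]]].
apply: (@eq_local_form _ _ _ _ _ _ _ _ (fun u r => 2^-1 * (a (side_point i s r) *
    - ddir (u (blk cm i)) (- normal s) (side_point i s r) + a (side_point i s r) *
    ddir (u (blk cm j)) (- normal s') (side_point j s' r)))).
  move=> u _ r; rewrite /= in_itv/= => /sP[_ eqr].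
  by rewrite mulrC nE -eqr.
apply: local_formZ; first exact: bounded_measurable_cst.
apply: local_formD => //; apply: local_formZ => //.
by apply: local_ddir => r; rewrite /= in_itv/= => /sP[].
Qed.

Lemma coarse_side_lt i s (K' : 'I_(nblk cm)) : (blk cm i < K')%N ->
  `[< exists j s', blk cm j = K' /\ fside i s = fside j s' >] ->
  coarse_side i (Some K') s.
Proof.
by move=> lt /asboolP ex; split=> // iK; rewrite iK ltnn in lt.
Qed.

Lemma global_form_skel {Y : Type} {J : finType} (P : Y -> Prop)
    (c : Y -> J -> R) (G : Y -> 'I_(nblk cm) -> option 'I_(nblk cm) ->
    R * R -> R * R -> R) :
  (forall i Km s, coarse_side i Km s -> local_form P c (side_dom i s)
     (fun y r => G y (blk cm i) Km (normal s) (side_point i s r))) ->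
  global_form P c (fun y => skel_int Omega (G y)).
Proof.
move=> lG; apply: global_formD.
  apply: global_form_sum => K _; apply: global_form_sum => K' KK'.
  apply: global_form_sum => i /eqP iK.
  apply: global_form_sum => s ss; subst; apply: global_form_integral.
  - exact: measurable_itv.
  - exact: lebesgue_bounded_itv_lty.
  - by apply: lG; exact: coarse_side_lt.
apply: global_form_sum => K _; apply: global_form_sum => i /eqP <-.
apply: global_form_sum => s /asboolP ss; apply: global_form_integral.
- exact: measurable_itv.
- exact: lebesgue_bounded_itv_lty.
- exact: lG.
Qed.

Lemma skel_int_ge0 (G : 'I_(nblk cm) -> option 'I_(nblk cm) ->
    R * R -> R * R -> R) :
  (forall i Km s, coarse_side i Km s -> forall r, side_lo i s <= r <= side_hi i s ->
     0 <= G (blk cm i) Km (normal s) (side_point i s r)) ->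
  0 <= skel_int Omega G.
Proof.
move=> G0; apply: addr_ge0.
  apply: sumr_ge0 => K _; apply: sumr_ge0 => K' KK'.
  apply: sumr_ge0 => i /eqP iK.
  apply: sumr_ge0 => s ss; subst; apply: Rintegral_ge0 => r.
  by rewrite /= in_itv/=; apply: G0; exact: coarse_side_lt.
apply: sumr_ge0 => K _; apply: sumr_ge0 => i /eqP <-.
apply: sumr_ge0 => s /asboolP ss; apply: Rintegral_ge0 => r.
by rewrite /= in_itv/=; exact: G0.
Qed.

(** The local forms are required for integrability, without which a pointwise inequality does not
    pass to the integrals. *)
Lemma le_skel_int {Y : Type} {J : finType} (P : Y -> Prop)
    (c : Y -> J -> R) (k : R) (F G : Y -> 'I_(nblk cm) ->
      option 'I_(nblk cm) -> R * R -> R * R -> R) y :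
  (forall i Km s, coarse_side i Km s -> local_form P c (side_dom i s)
     (fun y r => F y (blk cm i) Km (normal s) (side_point i s r))) ->
  (forall i Km s, coarse_side i Km s -> local_form P c (side_dom i s)
     (fun y r => G y (blk cm i) Km (normal s) (side_point i s r))) ->
  P y ->
  (forall i Km s, coarse_side i Km s -> forall r, side_lo i s <= r <= side_hi i s ->
     F y (blk cm i) Km (normal s) (side_point i s r) <=
     k * G y (blk cm i) Km (normal s) (side_point i s r)) ->
  skel_int Omega (F y) <= k * skel_int Omega (G y).
Proof.
move=> lF lG Py FG.
have le i Km s : coarse_side i Km s ->
    side_int i s (F y (blk cm i) Km (normal s)) <=
    k * side_int i s (G y (blk cm i) Km (normal s)).
  move=> cs.
  have mD : measurable (side_dom i s) by exact: measurable_itv.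
  have fD : (lebesgue_measure (side_dom i s) < +oo)%E.
    exact: lebesgue_bounded_itv_lty.
  rewrite /side_int -RintegralZl//; last first.
    exact: (local_form_integrable mD fD (lG _ _ _ cs) Py).
  apply: le_Rintegral => //.
  - exact: (local_form_integrable mD fD (lF _ _ _ cs) Py).
  - have lk : local_form P c (side_dom i s) (fun y r => k *
        G y (blk cm i) Km (normal s) (side_point i s r)).
      by apply: local_formZ (lG _ _ _ cs); exact: bounded_measurable_cst.
    exact: (local_form_integrable mD fD lk Py).
  - by move=> r; rewrite /= in_itv/=; exact: FG.
rewrite /skel_int mulrDr; apply: lerD.
  rewrite mulr_sumr; apply: ler_sum => K _.
  rewrite mulr_sumr; apply: ler_sum => K' KK'.
  rewrite mulr_sumr; apply: ler_sum => i /eqP iK.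
  rewrite mulr_sumr; apply: ler_sum => s ss; subst.
  by apply: le; exact: coarse_side_lt.
rewrite mulr_sumr; apply: ler_sum => K _.
rewrite mulr_sumr; apply: ler_sum => i /eqP <-.
rewrite mulr_sumr; apply: ler_sum => s /asboolP ss.
exact: le.
Qed.

End DiscreteForms.

(** * Sums of integrals over blocks *)

Section BlockIntegrals.
Context {R : realType} {fm : fine_mesh R} {cm : coarse_mesh fm}.
Context {Y : Type} {J : finType} (P : Y -> Prop) (c : Y -> J -> R).
Let plane := (measurableTypeR R * measurableTypeR R)%type.
Implicit Types (F G : Y -> 'I_(nblk cm) -> R * R -> R).

Lemma global_form_block F :
  (forall i, local_form P c (orect i : set plane) (fun y => F y (blk cm i))) ->
  global_form P c (fun y => \sum_K blk_int K (F y K)).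
Proof.
move=> lF; apply: global_form_sum => K _; apply: global_form_sum => i /eqP <-.
apply: global_form_integral; [exact: measurable_orect | exact: mu2_orect_lty |].
exact: lF.
Qed.

Lemma sum_blk_int_ge0 (f : 'I_(nblk cm) -> R * R -> R) :
  (forall i x, orect i x -> 0 <= f (blk cm i) x) ->
  0 <= \sum_K blk_int K (f K).
Proof.
move=> f0; apply: sumr_ge0 => K _; apply: sumr_ge0 => i /eqP <-.
by apply: Rintegral_ge0 => x; exact: f0.
Qed.

Lemma le_sum_blk_int (k : R) F G y :
  (forall i, local_form P c (orect i : set plane) (fun y => F y (blk cm i))) ->
  (forall i, local_form P c (orect i : set plane) (fun y => G y (blk cm i))) ->
  P y ->
  (forall i x, orect i x -> F y (blk cm i) x <= k * G y (blk cm i) x) ->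
  \sum_K blk_int K (F y K) <= k * \sum_K blk_int K (G y K).
Proof.
move=> lF lG Py FG; rewrite mulr_sumr; apply: ler_sum => K _.
rewrite mulr_sumr; apply: ler_sum => i /eqP <-.
have mD := measurable_orect i; have fD := mu2_orect_lty i.
rewrite -RintegralZl//; last exact: (local_form_integrable mD fD (lG i) Py).
apply: le_Rintegral => //.
- exact: (local_form_integrable mD fD (lF i) Py).
- have lk : local_form P c (orect i : set plane)
      (fun y x => k * G y (blk cm i) x).
    by apply: local_formZ (lG i); exact: bounded_measurable_cst.
  exact: (local_form_integrable mD fD lk Py).
- exact: FG.
Qed.

End BlockIntegrals.

(** * Symmetry, positivity and comparison of the discrete forms *)

Section EnergyForms.
Context {R : realType} {fm : fine_mesh R} {cm : coarse_mesh fm}.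
Context (Omega : set (R * R)) (meshP : is_fine_mesh fm Omega).
Implicit Types (u v : bfun cm) (w : R * R -> R).
Let plane := (measurableTypeR R * measurableTypeR R)%type.

Let coverE : closure Omega = \bigcup_(i in [set: 'I_(nrect fm)]) crect i.
Proof. by case: meshP. Qed.

Definition penalty w u v : R :=
  skel_int Omega (fun Kp Km _ x => w x * jump u Kp Km x * jump v Kp Km x).

(** One weighted form underlies both norms: [w = a] gives [norm_a] and [w = cst 1] gives
    [norm_H1]. *)
Definition broken_form w (h gamma : R) u v : R :=
  energy w u v + gamma / h * penalty w u v.

Lemma norm_aE w h gamma u :
  norm_a Omega w h gamma u = Num.sqrt (broken_form w h gamma u u).
Proof.
rewrite /norm_a /broken_form /penalty.
by under [in X in _ = X]eq_fun do under eq_fun do under eq_fun do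
  under eq_fun do rewrite -mulrA -expr2.
Qed.

Lemma norm_H1E h gamma u :
  norm_H1 Omega h gamma u = Num.sqrt (broken_form (cst 1) h gamma u u).
Proof.
rewrite -norm_aE /norm_H1 /norm_a.
by under [in X in _ = X]eq_fun do under eq_fun do under eq_fun do
  under eq_fun do rewrite mul1r.
Qed.

Lemma gdotC (f g : R * R -> R) x : gdot f g x = gdot g f x.
Proof. by rewrite /gdot (mulrC (dx f x)) (mulrC (dy f x)). Qed.

Lemma broken_formC w h gamma u v :
  broken_form w h gamma u v = broken_form w h gamma v u.
Proof.
have Eq : energy w u v = energy w v u.
  apply: eq_bigr => K _; congr (blk_int K _); apply/funext => x.
  by rewrite gdotC.
have Pe : penalty w u v = penalty w v u.
  rewrite /penalty; congr (skel_int Omega _).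
  by do 4 (apply/funext => ?); exact: mulrAC.
by rewrite /broken_form Eq Pe.
Qed.

Lemma aDGC w h gamma u v : aDG Omega w h gamma u v = aDG Omega w h gamma v u.
Proof.
rewrite /aDG; have := broken_formC w h gamma u v.
rewrite /broken_form /penalty; set e := energy w u v; set e' := energy w v u.
set f := skel_int _ _; set f' := skel_int _ _.
by set g := skel_int _ _; set g' := skel_int _ _; move=> E; lra.
Qed.

Lemma ipC u v : ip u v = ip v u.
Proof.
apply: eq_bigr => K _; congr blk_int; apply/funext => x; exact: mulrC.
Qed.

Lemma nodal_bilinear_ip : nodal_bilinear (@ip R fm cm).
Proof.
apply: (global_form_block (F := fun y K x => y.1 K x * y.2 K x)) => i.
by apply: (local_formM (F := fun u x => u (blk cm i) x)
  (G := fun u x => u (blk cm i) x)); exact: (local_value meshP).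
Qed.

Lemma ip_ge0 u : 0 <= ip u u.
Proof. by apply: sum_blk_int_ge0 => i x _; rewrite -expr2 sqr_ge0. Qed.

Section Coefficient.
Context (w : R * R -> R) (w0 w1 : R) (hw : coefficient Omega w w0 w1).

Lemma local_gdot i :
  local_form (pair_prop (@piecewise_bilinear R fm cm))
    (pair_coord (@nodal R fm cm)) (orect i : set plane)
    (fun y x => w x * gdot (y.1 (blk cm i)) (y.2 (blk cm i)) x).
Proof.
apply: local_formZ.
  exact: (bounded_measurable_coefficient coverE hw).
apply: local_formD.
  by apply: (local_formM (F := fun u x => dx (u (blk cm i)) x)
    (G := fun u x => dx (u (blk cm i)) x)); exact: (local_dx meshP).
by apply: (local_formM (F := fun u x => dy (u (blk cm i)) x)
  (G := fun u x => dy (u (blk cm i)) x)); exact: (local_dy meshP).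
Qed.

Lemma local_jump2 i Km s : coarse_side Omega i Km s ->
  local_form (pair_prop (@piecewise_bilinear R fm cm))
    (pair_coord (@nodal R fm cm))
    ([set` `[side_lo i s, side_hi i s]] : set (measurableTypeR R))
    (fun y r => w (side_point i s r) * jump y.1 (blk cm i) Km (side_point i s r)
      * jump y.2 (blk cm i) Km (side_point i s r)).
Proof.
move=> cs; apply: (@eq_local_form _ _ _ _ _ _ _ _ (fun y r =>
   w (side_point i s r) * (jump y.1 (blk cm i) Km (side_point i s r) *
     jump y.2 (blk cm i) Km (side_point i s r)))).
  by move=> y _ r _; rewrite mulrA.
have nondeg : forall i : 'I_(nrect fm),
    (lowc i).1 < (uppc i).1 /\ (lowc i).2 < (uppc i).2.
  by case: meshP.
apply: (local_formZ (w := fun r => w (side_point i s r))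
  (F := fun y r => jump y.1 (blk cm i) Km (side_point i s r) *
     jump y.2 (blk cm i) Km (side_point i s r))).
  exact: (bounded_measurable_coefficient_side coverE hw i s nondeg).
by apply: (local_formM
  (F := fun u r => jump u (blk cm i) Km (side_point i s r))
  (G := fun u r => jump u (blk cm i) Km (side_point i s r)));
  exact: (local_jump meshP).
Qed.

Lemma nodal_bilinear_broken_form h gamma :
  nodal_bilinear (cm := cm) (broken_form w h gamma).
Proof.
apply: global_formD.
  by apply: (global_form_block (F := fun y K x => w x * gdot (y.1 K) (y.2 K) x));
    exact: local_gdot.
apply: global_formZ; apply: (global_form_skel (G := fun y Kp Km _ x =>
  w x * jump y.1 Kp Km x * jump y.2 Kp Km x)) => i Km s.
exact: local_jump2.
Qed.

Lemma nodal_bilinear_aDG h gamma : nodal_bilinear (cm := cm) (aDG Omega w h gamma).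
Proof.
apply: (@eq_global_form _ _ _ _ _ (fun y => broken_form w h gamma y.1 y.2 +
  (-1 * skel_int Omega (fun Kp Km n x => avg_flux w y.1 Kp Km n x * jump y.2 Kp Km x)
  + -1 * skel_int Omega (fun Kp Km n x => avg_flux w y.2 Kp Km n x * jump y.1 Kp Km x)))).
  by move=> y _; rewrite /aDG /broken_form /penalty; ring.
apply: global_formD; first exact: nodal_bilinear_broken_form.
apply: global_formD; apply: global_formZ.
  apply: (global_form_skel (G := fun y Kp Km n x =>
    avg_flux w y.1 Kp Km n x * jump y.2 Kp Km x)) => i Km s cs.
  apply: (local_formM (F := fun u r => avg_flux w u (blk cm i) Km (normal s)
    (side_point i s r)) (G := fun u r => jump u (blk cm i) Km (side_point i s r))).
    exact: (local_avg_flux meshP hw cs).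
  exact: (local_jump meshP cs).
apply: (global_form_skel (G := fun y Kp Km n x =>
  avg_flux w y.2 Kp Km n x * jump y.1 Kp Km x)) => i Km s cs.
(* The factors are swapped because [local_formM] takes the first one from [y.1]. *)
apply: (@eq_local_form _ _ _ _ _ _ _ _ (fun y r =>
  jump y.1 (blk cm i) Km (side_point i s r) *
  avg_flux w y.2 (blk cm i) Km (normal s) (side_point i s r))).
  by move=> y _ r _; rewrite mulrC.
apply: (local_formM (F := fun u r => jump u (blk cm i) Km (side_point i s r))
  (G := fun u r => avg_flux w u (blk cm i) Km (normal s) (side_point i s r))).
  exact: (local_jump meshP cs).
exact: (local_avg_flux meshP hw cs).
Qed.

Lemma side_in_closure (i : 'I_(nrect fm)) s r : side_lo i s <= r <= side_hi i s ->
  closure Omega (side_point i s r).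
Proof.
move=> rs; apply: (crect_closure coverE (i := i)); apply: crect_side_point => //.
by case: meshP.
Qed.

Lemma rect_in_closure (i : 'I_(nrect fm)) x : orect i x -> closure Omega x.
Proof. by move=> /orect_crect; exact: crect_closure. Qed.

Context (w0_ge0 : 0 <= w0).

Let w_ge0 x : closure Omega x -> 0 <= w x.
Proof. by move=> /(proj2 hw)/andP[? _]; exact: le_trans w0_ge0 _. Qed.

Lemma gdot_ge0 (f : R * R -> R) x : 0 <= gdot f f x.
Proof. by rewrite /gdot -!expr2 addr_ge0 ?sqr_ge0. Qed.

Lemma broken_form_ge0 h gamma u : 0 <= gamma / h ->
  0 <= broken_form w h gamma u u.
Proof.
move=> gh; rewrite addr_ge0//.
  apply: sum_blk_int_ge0 => i x /rect_in_closure Ox.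
  by rewrite mulr_ge0 ?w_ge0 ?gdot_ge0.
rewrite mulr_ge0//; apply: skel_int_ge0 => i Km s _ r /side_in_closure Or.
by rewrite -mulrA -expr2 mulr_ge0 ?w_ge0 ?sqr_ge0.
Qed.

End Coefficient.

Lemma le_broken_form w (w0 w1 : R) h gamma u :
  coefficient Omega w w0 w1 -> 0 <= gamma / h -> piecewise_bilinear u ->
  broken_form w h gamma u u <= w1 * broken_form (cst 1) h gamma u u.
Proof.
move=> hw gh bu.
(* The constant weight is itself a coefficient, so the H^1 form inherits the local representations
   proved for [w]. *)
have h1 : coefficient Omega (cst 1) 1 1.
  by split=> [|x _]; [exact: measurable_cst | rewrite /= lexx].
rewrite /broken_form [leRHS]mulrDr; apply: lerD.
  apply: (@le_sum_blk_int _ _ _ _ _ _ _ _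
    (fun y K x => w x * gdot (y.1 K) (y.2 K) x)
    (fun y K x => cst 1 x * gdot (y.1 K) (y.2 K) x) (u, u)
    (local_gdot hw) (local_gdot h1)) => // i x /rect_in_closure Ox.
  by rewrite mul1r ler_wpM2r ?gdot_ge0//; case: hw => _ /(_ _ Ox)/andP[].
rewrite [w1 * _]mulrCA ler_wpM2l//.
apply: (@le_skel_int _ _ _ _ _ _ _ _ _
    (fun y Kp Km _ x => w x * jump y.1 Kp Km x * jump y.2 Kp Km x)
    (fun y Kp Km _ x => cst 1 x * jump y.1 Kp Km x * jump y.2 Kp Km x) (u, u)
    (local_jump2 hw) (local_jump2 h1)) => // i Km s _ r /side_in_closure Or.
rewrite /= mul1r -mulrA ler_wpM2r -?expr2 ?sqr_ge0//.
by case: hw => _ /(_ _ Or)/andP[].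
Qed.

End EnergyForms.

(** * Linearity, Cauchy-Schwarz and the triangle inequality through nodal values *)

Section NodalAlgebra.
Context {R : realType} {fm : fine_mesh R} {cm : coarse_mesh fm}.
Implicit Types (u v z : bfun cm) (k : R).
Context (B : bfun cm -> bfun cm -> R) (bB : nodal_bilinear B).

(** The hypothesis on [z] concerns its nodal values only. This matters for time derivatives of
    differences, whose values off the blocks are uncontrolled. *)
Lemma nodal_bilinear_combl k u v z t :
  piecewise_bilinear u -> piecewise_bilinear v -> piecewise_bilinear z ->
  piecewise_bilinear t ->
  (forall j, nodal z j = nodal u j + k * nodal v j) ->
  B z t = B u t + k * B v t.
Proof.
case: bB => M BE bu bv bz bt zE.
rewrite (BE (z, t))// (BE (u, t))// (BE (v, t))// mulr_sumr -big_split/=.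
by apply: eq_bigr => j _; rewrite /pair_coord/= zE; ring.
Qed.

Context (symB : forall u v, B u v = B v u).
Context (B_ge0 : forall u, piecewise_bilinear u -> 0 <= B u u).

Lemma nodal_bilinear_CauchySchwarz u v :
  piecewise_bilinear u -> piecewise_bilinear v ->
  `|B u v| <= Num.sqrt (B u u) * Num.sqrt (B v v).
Proof.
move=> bu bv; have u0 := B_ge0 bu; have v0 := B_ge0 bv.
have q k : 0 <= B u u + 2 * k * B u v + k ^+ 2 * B v v.
  have bz := piecewise_bilinear_comb k bu bv.
  have := B_ge0 bz.
  rewrite (@nodal_bilinear_combl k u v)// (symB u) (symB v).
  rewrite (@nodal_bilinear_combl k u v _ u)// (@nodal_bilinear_combl k u v _ v)//.
  by rewrite (symB v u) => /le_trans; apply; lra.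
rewrite -sqrtrM// -sqrtr_sqr ler_sqrt ?mulr_ge0//.
have [v00|vn0] := eqVneq (B v v) 0.
  have [->|b0] := eqVneq (B u v) 0; first by rewrite expr0n mulr_ge0.
  (* The form is only semidefinite. If [B v v = 0] the polynomial is affine in [k], and this [k]
     would give it the value -1. *)
  have := q (- (B u u + 1) / (2 * B u v)); rewrite v00 mulr0 addr0.
  rewrite (_ : 2 * _ * _ = - (B u u + 1)); last by field.
  by lra.
(* The minimiser of the quadratic polynomial. *)
have := q (- B u v / B v v).
have {}v0 : 0 < B v v by rewrite lt_neqAle eq_sym vn0.
rewrite (_ : _ + _ = (B u u * B v v - B u v ^+ 2) / B v v); last by field.
by rewrite pmulr_lge0 ?invr_gt0// subr_ge0.
Qed.

Lemma nodal_bilinear_triangle u v z :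
  piecewise_bilinear u -> piecewise_bilinear v -> piecewise_bilinear z ->
  (forall j, nodal z j = nodal u j - nodal v j) ->
  Num.sqrt (B z z) <= Num.sqrt (B u u) + Num.sqrt (B v v).
Proof.
move=> bu bv bz zE.
have zE' j : nodal z j = nodal u j + -1 * nodal v j by rewrite zE mulN1r.
have BzE : B z z = B u u - 2 * B u v + B v v.
  rewrite (nodal_bilinear_combl bu bv bz bz zE') (symB u) (symB v).
  rewrite (nodal_bilinear_combl bu bv bz bu zE').
  by rewrite (nodal_bilinear_combl bu bv bz bv zE') (symB v u); ring.
rewrite -[leRHS]ger0_norm ?addr_ge0// -sqrtr_sqr ler_wsqrtr//.
rewrite BzE sqrrD !sqr_sqrtr ?B_ge0//.
have := nodal_bilinear_CauchySchwarz bu bv; have := ler_norm (- B u v).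
by rewrite normrN -mulr_natl; lra.
Qed.

End NodalAlgebra.

(** * One-sided derivatives on a compact interval *)

Section OneSidedDerivative.
Context {R : realType} (T : R) (hT : 0 < T).
Implicit Types (f g E : R -> R) (t l : R).

(** Makes limits along this filter unique, also at the end points, so that [dt] can be identified.
    Nearby points are found to the right of [t] when [t < T], and to the left of [T] otherwise. *)
Lemma within_dnbhs_proper t : t \in `[0, T] ->
  ProperFilter (within `[0, T] t^').
Proof.
rewrite in_itv/= => /andP[t0 tT]; apply: Build_ProperFilter_ex => P.
move=> /nbhs_ballP[e /= e0 eP].
have [d [d0 dT de]] : exists d, [/\ d != 0, 0 <= t + d <= T & `|d| < e].
  have [tT'|] := ltP t T.
    have m0 : 0 < Num.min (e / 2) (T - t) by rewrite lt_min subr_gt0 tT' divr_gt0.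
    exists (Num.min (e / 2) (T - t)); split; first exact: lt0r_neq0.
      have : Num.min (e / 2) (T - t) <= T - t by rewrite ge_min lexx orbT.
      by move=> ?; apply/andP; split; lra.
    rewrite gtr0_norm//; have : Num.min (e / 2) (T - t) <= e / 2.
      by rewrite ge_min lexx.
    by move=> ?; lra.
  move=> Tt; have m0 : 0 < Num.min (e / 2) T by rewrite lt_min hT divr_gt0.
  have m1 : Num.min (e / 2) T <= e / 2 by rewrite ge_min lexx.
  have m2 : Num.min (e / 2) T <= T by rewrite ge_min lexx orbT.
  exists (- Num.min (e / 2) T); split; first by rewrite oppr_eq0 lt0r_neq0.
    by apply/andP; split; lra.
  by rewrite normrN gtr0_norm//; lra.
exists (t + d); apply: (eP (t + d)) => /=.
- by rewrite /ball/= opprD addNKr normrN.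
- by rewrite -subr_eq0 addrAC subrr add0r.
- by rewrite in_itv.
Qed.

(** Uses the filter that defines [dt], hence is one-sided at 0 and at T, where [is_derive] would
    look outside the interval. *)
Definition has_slope f t l :=
  (f s - f t) / (s - t) @[s --> within `[0, T] t^'] --> l.

Lemma within_dnbhsP t (P : set R) :
  within `[0, T] t^' P <-> \forall s \near t, s != t -> s \in `[0, T] -> P s.
Proof. by []. Qed.

Lemma eq_cvg_within f g t l :
  (forall s, s != t -> s \in `[0, T] -> f s = g s) ->
  f s @[s --> within `[0, T] t^'] --> l -> g s @[s --> within `[0, T] t^'] --> l.
Proof.
move=> fg; apply: cvg_trans; apply: near_eq_cvg.
by apply/within_dnbhsP; near=> s => st sT; rewrite fg.
Unshelve. all: by end_near.
Qed.

Lemma has_slope_unique f t l l' : t \in `[0, T] ->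
  has_slope f t l -> has_slope f t l' -> l = l'.
Proof.
by move=> /within_dnbhs_proper ?; exact: cvg_unique.
Qed.

Lemma eq_has_slope f g t l : t \in `[0, T] ->
  (forall s, s \in `[0, T] -> f s = g s) -> has_slope f t l -> has_slope g t l.
Proof. by move=> tT fg; apply: eq_cvg_within => s _ sT; rewrite !fg. Qed.

Lemma has_slope_cst (k : R) t : has_slope (fun=> k) t 0.
Proof.
rewrite /has_slope; under eq_fun do rewrite subrr mul0r; exact: cvg_cst.
Qed.

Lemma has_slopeD f g t l l' : has_slope f t l -> has_slope g t l' ->
  has_slope (fun s => f s + g s) t (l + l').
Proof.
move=> fl gl; rewrite /has_slope.
under eq_fun do rewrite opprD addrACA mulrDl.
exact: cvgD.
Qed.

Lemma has_slopeZ (k : R) f t l : has_slope f t l ->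
  has_slope (fun s => k * f s) t (k * l).
Proof.
move=> fl; rewrite /has_slope; under eq_fun do rewrite -mulrBr -mulrA.
exact: cvgM (cvg_cst k) fl.
Qed.

Lemma has_slope_cvg f t l : has_slope f t l ->
  f s @[s --> within `[0, T] t^'] --> f t.
Proof.
move=> fl.
have c0 : (s - t) @[s --> within `[0, T] t^'] --> (0 : R).
  rewrite -(subrr t); apply: cvgB; last exact: cvg_cst.
  by apply: cvg_trans (cvg_within _) _; exact: cvg_within.
have H : f t + (f s - f t) / (s - t) * (s - t)
    @[s --> within `[0, T] t^'] --> f t + l * 0.
  by apply: cvgD; [exact: cvg_cst | exact: cvgM].
move: H; rewrite mulr0 addr0; apply: eq_cvg_within => s st _.
by rewrite divfK ?subr_eq0// addrC subrK.
Qed.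

Lemma has_slopeM f g t l l' : has_slope f t l -> has_slope g t l' ->
  has_slope (fun s => f s * g s) t (l * g t + f t * l').
Proof.
move=> fl gl; have gc := has_slope_cvg gl.
have : (f s - f t) / (s - t) * g s + f t * ((g s - g t) / (s - t))
    @[s --> within `[0, T] t^'] --> l * g t + f t * l'.
  by apply: cvgD; [exact: cvgM | apply: cvgM => //; exact: cvg_cst].
apply: eq_cvg_within => s _ _.
by rewrite mulrAC mulrA -mulrDl; congr (_ / _); ring.
Qed.

Lemma has_slope_sum (I : Type) (r : seq I) (f : I -> R -> R) t (l : I -> R) :
  (forall i, has_slope (f i) t (l i)) ->
  has_slope (fun s => \sum_(i <- r) f i s) t (\sum_(i <- r) l i).
Proof.
move=> fl; elim: r => [|i r IH].
  rewrite big_nil; under eq_fun do rewrite big_nil; exact: has_slope_cst.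
rewrite big_cons; under eq_fun do rewrite big_cons; exact: has_slopeD.
Qed.

Lemma has_slope_continuous f (df : R -> R) :
  (forall t, t \in `[0, T] -> has_slope f t (df t)) ->
  {within `[0, T], continuous f}.
Proof.
move=> fdf; apply/subspace_continuousP => t tT U Uft.
have /within_dnbhsP := has_slope_cvg (fdf t tT) Uft.
rewrite /= /within/=; apply: filterS => s H sT.
by have [->|st] := eqVneq s t; [exact: (nbhs_singleton Uft) | exact: H].
Qed.

(** Near an interior point the restriction to [[0, T]] is vacuous; the difference quotient completed
    by [l] at [t] is the Caratheodory function. *)
Lemma has_slope_is_derive f t l : t \in `]0, T[ -> has_slope f t l ->
  is_derive t 1 f l.
Proof.
move=> tT fl; apply/is_derive1_caratheodory.
exists (fun s => if s == t then l else (f s - f t) / (s - t)); split.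
- move=> s; have [->|st] := eqVneq s t; first by rewrite !subrr mulr0.
  by rewrite divfK// subr_eq0.
- move=> U; rewrite /= eqxx => Ul; have /within_dnbhsP := fl U Ul.
  apply: filterS2 (near_in_itvoo tT) => s sT H /=.
  have [st|st] := eqVneq s t; first exact: (nbhs_singleton Ul).
  by apply: H => //; exact: subset_itv_oo_cc sT.
- by rewrite eqxx.
Qed.

(** Slopes are derivatives in the open interval, and at the end points they supply the one-sided
    continuity that the fundamental theorem asks for. *)
Lemma has_slope_FTC2 f (df : R -> R) t :
  (forall t, t \in `[0, T] -> has_slope f t (df t)) ->
  {within `[0, T], continuous df} -> t \in `]0, T] ->
  \int[lebesgue_measure]_(s in `[0, t]) df s = f t - f 0.
Proof.
move=> fdf cdf; rewrite in_itv/= => /andP[t0 tT].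
have sub : `[0, t] `<=` `[0, T] by apply: subset_itvl; rewrite bnd_simp.
have dE s : s \in `]0, t[ -> is_derive s 1 f (df s).
  rewrite in_itv/= => /andP[s0 st]; apply: has_slope_is_derive.
    by rewrite in_itv/= s0 (lt_le_trans st).
  by apply: fdf; rewrite in_itv/= !ltW// (lt_le_trans st).
rewrite /Rintegral (@continuous_FTC2 _ _ f)//.
- exact: continuous_subspaceW sub cdf.
- have /(continuous_subspaceW sub) := has_slope_continuous fdf.
  move=> /(continuous_within_itvP _ t0)[_ f0 ft]; split=> // s /dE ds.
  exact: ex_derive.
- by move=> s /dE ds; rewrite derive1E derive_val.
Qed.

(* At a maximum point c of E, with M = sqrt (E c), integrating E' <= 2 g M gives
   M ^+ 2 <= E 0 + 2 M L, hence M <= sqrt (E 0) + 2 L. *)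
Lemma energy_estimate E (dE g : R -> R) t :
  (forall t, t \in `[0, T] -> has_slope E t (dE t)) ->
  {within `[0, T], continuous dE} -> {within `[0, T], continuous g} ->
  (forall t, t \in `[0, T] -> 0 <= E t) ->
  (forall t, t \in `[0, T] -> 0 <= g t) ->
  (forall t, t \in `[0, T] -> dE t <= 2 * g t * Num.sqrt (E t)) ->
  t \in `[0, T] ->
  Num.sqrt (E t) <= Num.sqrt (E 0) +
    2 * \int[lebesgue_measure]_(s in `[0, T]) g s.
Proof.
move=> Ed cdE cg E0 g0 dEg tT.
have [c cT cmax] := EVT_max (ltW hT) (has_slope_continuous Ed).
apply: (@le_trans _ _ (Num.sqrt (E c))); first by rewrite ler_wsqrtr ?cmax.
set L := (X in 2 * X); set M := Num.sqrt (E c).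
have M0 : 0 <= M by exact: sqrtr_ge0.
have L0 : 0 <= L by apply: Rintegral_ge0 => s; exact: g0.
(* A maximum at 0 gives the bound at once; otherwise [[0, c]] is nondegenerate and [has_slope_FTC2]
   applies. *)
have [c0|c0] := eqVneq c 0.
  by rewrite /M c0 lerDl mulr_ge0.
have {}c0 : c \in `]0, T].
  by move: cT; rewrite !in_itv/= => /andP[? ->]; rewrite lt_neqAle eq_sym c0 andbT.
have sub : `[0, c] `<=` `[0, T].
  by apply: subset_itvl; rewrite bnd_simp; move: c0; rewrite in_itv/= => /andP[].
have icc (h : R -> R) : {within `[0, T], continuous h} ->
    lebesgue_measure.-integrable `[0, c] (EFin \o h).
  move=> ch; apply: continuous_compact_integrable; first exact: segment_compact.
  exact: continuous_subspaceW sub ch.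
have igT : lebesgue_measure.-integrable `[0, T] (EFin \o g).
  by apply: continuous_compact_integrable; first exact: segment_compact.
have gL : \int[lebesgue_measure]_(s in `[0, c]) g s <= L.
  have i1 : (\int[lebesgue_measure]_(s in `[0%R, c]) (g s)%:E \is a fin_num)%E.
    by apply: integrable_fin_num => //; exact: icc.
  have i2 : (\int[lebesgue_measure]_(s in `[0%R, T]) (g s)%:E \is a fin_num)%E.
    exact: integrable_fin_num.
  apply: fine_le i1 i2 _; apply: ge0_subset_integral => //=.
  by case/integrableP : igT.
have EM : E c - E 0 <= 2 * M * L.
  rewrite -(has_slope_FTC2 Ed cdE c0).
  apply: le_trans (ler_wpM2l (mulr_ge0 (ler0n _ 2) M0) gL).
  rewrite -RintegralZl//; last exact: icc.
  have i2 : lebesgue_measure.-integrable `[0, c] (EFin \o (fun s => 2 * M * g s)).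
    by apply: (icc (fun s => 2 * M * g s))  => s; exact: cvgM (cvg_cst _) (cg s).
  apply: le_Rintegral => //; first exact: icc.
  move=> s /sub sT; apply: le_trans (dEg s sT) _.
  by rewrite -!mulrA ler_wpM2l// [M * _]mulrC ler_wpM2l ?g0// ler_wsqrtr// cmax.
have Ec : E c = M ^+ 2 by rewrite sqr_sqrtr// E0.
have e0 : E 0 = Num.sqrt (E 0) ^+ 2.
  by rewrite sqr_sqrtr// E0// in_itv/= lexx ltW.
have := sqrtr_ge0 (E 0); move: e0; set S := Num.sqrt _ => e0 S0.
(* If M > S + 2 L, then M^2 > M S + 2 M L >= S^2 + 2 M L, against [EM]. *)
rewrite leNgt; apply/negP => SM.
have : S * S <= M * S by rewrite ler_wpM2r//; lra.
rewrite Ec e0 !expr2 in EM.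
have Mp : 0 < M by lra.
have : M * (S + 2 * L) < M * M by rewrite ltr_pM2l.
by lra.
Qed.

End OneSidedDerivative.

(** * Time-dependent piecewise bilinear functions and the abstract wave estimate *)

Section Trajectories.
Context {R : realType} {fm : fine_mesh R} {cm : coarse_mesh fm}.
Context (nondeg : forall i : 'I_(nrect fm),
  (lowc i).1 < (uppc i).1 /\ (lowc i).2 < (uppc i).2).
Context (T : R) (hT : 0 < T).
Implicit Types (u v : R -> bfun cm) (t : R) (K : 'I_(nblk cm)).

Lemma dtP u t K x :
  cvg (diff_quot u t K x s @[s --> within `[0, T] t^']) ->
  has_slope T (fun s => u s K x) t (dt T u t K x).
Proof. by []. Qed.

Lemma dtE u t K x l : t \in `[0, T] -> has_slope T (fun s => u s K x) t l ->
  dt T u t K x = l.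
Proof. by move=> /(within_dnbhs_proper hT) ?; exact: cvg_lim. Qed.

Definition trajectory u :=
  time_C2 T u /\ forall t, t \in `[0, T] -> piecewise_bilinear (u t).

Lemma bilinear_hat (i : 'I_(nrect fm)) b : bilinear_on (crect i) (hat i b).
Proof.
pose p (lo hi : R) (c : bool) := (if c then - lo else hi) / (hi - lo).
pose q (lo hi : R) (c : bool) := (if c then 1 else -1) / (hi - lo).
have hE lo hi c (s : R) : hat1 lo hi c s = p lo hi c + q lo hi c * s.
  by rewrite /hat1 /p /q; case: c; ring.
exists (p (lowc i).1 (uppc i).1 b.1 * p (lowc i).2 (uppc i).2 b.2),
  (q (lowc i).1 (uppc i).1 b.1 * p (lowc i).2 (uppc i).2 b.2),
  (p (lowc i).1 (uppc i).1 b.1 * q (lowc i).2 (uppc i).2 b.2),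
  (q (lowc i).1 (uppc i).1 b.1 * q (lowc i).2 (uppc i).2 b.2) => x _.
by rewrite /hat !hE; ring.
Qed.

(** The hat functions do not depend on time, so differentiating the interpolation formula turns the
    corner values into their time derivatives and keeps the function bilinear. *)
Lemma piecewise_bilinear_dt u t :
  (forall K x, block K x ->
     cvg (diff_quot u t K x s @[s --> within `[0, T] t^'])) ->
  (forall s, s \in `[0, T] -> piecewise_bilinear (u s)) -> t \in `[0, T] ->
  piecewise_bilinear (dt T u t).
Proof.
move=> cu bu tT i; set K := blk cm i.
have [c0 [c1 [c2 [c3 H]]]] := @bilinear_sum R (crect i) _
  (index_enum (bool * bool)%type) xpredT (fun b => dt T u t K (vertex i b))
  (hat i) (fun b _ => bilinear_hat i b).
exists c0, c1, c2, c3 => x ix; rewrite -H//; apply: dtE => //.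
apply: (@eq_has_slope _ _ (fun s => \sum_b hat i b x * u s K (vertex i b))) => //.
  by move=> s sT; rewrite (bilinear_interpolation nondeg (bu s sT i) ix).
under eq_bigr do rewrite mulrC.
apply: has_slope_sum => b; apply: has_slopeZ; apply: dtP; apply: cu.
exact/crect_block/crect_vertex.
Qed.

Lemma nodal_has_slope u t j :
  (forall K x, block K x ->
     cvg (diff_quot u t K x s @[s --> within `[0, T] t^'])) ->
  has_slope T (fun s => nodal (u s) j) t (nodal (dt T u t) j).
Proof.
by move=> cu; apply: dtP; apply: cu; exact/crect_block/crect_vertex.
Qed.

Section OneTrajectory.
Context (u : R -> bfun cm) (tu : trajectory u).

Let cvg1 t : t \in `[0, T] -> forall K x, block K x ->
  cvg (diff_quot u t K x s @[s --> within `[0, T] t^']).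
Proof. by case: tu => C2 _ tT K x /C2[+ _ _]; exact. Qed.

Let cvg2 t : t \in `[0, T] -> forall K x, block K x ->
  cvg (diff_quot (dt T u) t K x s @[s --> within `[0, T] t^']).
Proof. by case: tu => C2 _ tT K x /C2[_ + _]; exact. Qed.

Lemma trajectory_bilinear0 t : t \in `[0, T] -> piecewise_bilinear (u t).
Proof. by case: tu => _; exact. Qed.

Lemma trajectory_bilinear1 t : t \in `[0, T] -> piecewise_bilinear (dt T u t).
Proof.
move=> tT; apply: piecewise_bilinear_dt (cvg1 tT) _ tT.
exact: trajectory_bilinear0.
Qed.

Lemma trajectory_bilinear2 t : t \in `[0, T] ->
  piecewise_bilinear (dt T (dt T u) t).
Proof.
move=> tT; apply: piecewise_bilinear_dt (cvg2 tT) _ tT.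
exact: trajectory_bilinear1.
Qed.

Lemma trajectory_slope1 t j : t \in `[0, T] ->
  has_slope T (fun s => nodal (u s) j) t (nodal (dt T u t) j).
Proof. by move=> tT; apply: nodal_has_slope; exact: cvg1. Qed.

Lemma trajectory_slope2 t j : t \in `[0, T] ->
  has_slope T (fun s => nodal (dt T u s) j) t (nodal (dt T (dt T u) t) j).
Proof. by move=> tT; apply: nodal_has_slope; exact: cvg2. Qed.

Lemma trajectory_continuous1 j :
  {within `[0, T], continuous (fun t => nodal (dt T u t) j)}.
Proof. by apply: has_slope_continuous => t; exact: trajectory_slope2. Qed.

Lemma trajectory_continuous2 j :
  {within `[0, T], continuous (fun t => nodal (dt T (dt T u) t) j)}.
Proof.
case: tu => C2 _; have [] // := C2 _ _ (crect_block (crect_vertex nondeg j.1 j.2)).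
Qed.

End OneTrajectory.

Section Difference.
Context (u v : R -> bfun cm) (tu : trajectory u) (tv : trajectory v).
Let w : R -> bfun cm := fun t K x => u t K x - v t K x.

Let slopeB (f g : R -> bfun cm) t K x :
  cvg (diff_quot f t K x s @[s --> within `[0, T] t^']) ->
  cvg (diff_quot g t K x s @[s --> within `[0, T] t^']) ->
  has_slope T (fun s => f s K x - g s K x) t (dt T f t K x - dt T g t K x).
Proof.
move=> /dtP cf /dtP cg; rewrite -mulN1r; under eq_fun do rewrite -mulN1r.
by apply: has_slopeD => //; exact: has_slopeZ.
Qed.

Let slope1 t K x : t \in `[0, T] -> block K x ->
  has_slope T (fun s => w s K x) t (dt T u t K x - dt T v t K x).
Proof.
move: tu tv => [C2u _] [C2v _] tT Kx.
by have [cu _ _] := C2u _ _ Kx; have [cv _ _] := C2v _ _ Kx; apply: slopeB; auto.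
Qed.

(** Restricted to the block: elsewhere [time_C2] provides no limits, and [dt] need not be
    additive. *)
Lemma dt_trajectoryB t K x : t \in `[0, T] -> block K x ->
  dt T w t K x = dt T u t K x - dt T v t K x.
Proof. by move=> tT Kx; apply: dtE => //; exact: slope1. Qed.

Let slope2 t K x : t \in `[0, T] -> block K x ->
  has_slope T (fun s => dt T w s K x) t
    (dt T (dt T u) t K x - dt T (dt T v) t K x).
Proof.
move: (tu) (tv) => [C2u _] [C2v _] tT Kx.
have [_ cu _] := C2u _ _ Kx; have [_ cv _] := C2v _ _ Kx.
apply: (@eq_has_slope _ _ (fun s => dt T u s K x - dt T v s K x)) => //.
  by move=> s sT; rewrite dt_trajectoryB.
by apply: slopeB; auto.
Qed.

Lemma dt2_trajectoryB t K x : t \in `[0, T] -> block K x ->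
  dt T (dt T w) t K x = dt T (dt T u) t K x - dt T (dt T v) t K x.
Proof. by move=> tT Kx; apply: dtE => //; exact: slope2. Qed.

Lemma trajectoryB : trajectory w.
Proof.
split=> [K x Kx|t tT].
  move: (tu) (tv) => [C2u _] [C2v _].
  have [_ _ cu] := C2u _ _ Kx; have [_ _ cv] := C2v _ _ Kx.
  split=> [t tT|t tT|]; [exact: cvgP (slope1 tT Kx) | exact: cvgP (slope2 tT Kx)|].
  apply: (@subspace_eq_continuous _ _ _
    (fun t => dt T (dt T u) t K x - dt T (dt T v) t K x)).
    by move=> t /set_mem tT; apply/esym/dt2_trajectoryB.
  by move=> t; exact: cvgB (cu t) (cv t).
by apply: piecewise_bilinearB; exact: trajectory_bilinear0.
Qed.

Lemma nodal_dt_trajectoryB t j : t \in `[0, T] ->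
  nodal (dt T w t) j = nodal (dt T u t) j - nodal (dt T v t) j.
Proof.
by move=> tT; apply: dt_trajectoryB => //; exact/crect_block/crect_vertex.
Qed.

Lemma nodal_dt2_trajectoryB t j : t \in `[0, T] ->
  nodal (dt T (dt T w) t) j =
  nodal (dt T (dt T u) t) j - nodal (dt T (dt T v) t) j.
Proof.
by move=> tT; apply: dt2_trajectoryB => //; exact/crect_block/crect_vertex.
Qed.

End Difference.

Section BilinearInTime.
Context (B : bfun cm -> bfun cm -> R) (bB : nodal_bilinear B).
Let bilinear_in_time u :=
  forall s, s \in `[0, T] -> piecewise_bilinear (u s).

(** Differentiation under the integral sign becomes the product rule in a finite sum with
    coefficients constant in time. *)
Lemma has_slope_bilinear u v (du dv : bfun cm) t : t \in `[0, T] ->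
  bilinear_in_time u -> bilinear_in_time v ->
  piecewise_bilinear du -> piecewise_bilinear dv ->
  (forall j, has_slope T (fun s => nodal (u s) j) t (nodal du j)) ->
  (forall j, has_slope T (fun s => nodal (v s) j) t (nodal dv j)) ->
  has_slope T (fun s => B (u s) (v s)) t (B du (v t) + B (u t) dv).
Proof.
case: bB => M BE tT bu bv bdu bdv su sv.
apply: (@eq_has_slope _ _
  (fun s => \sum_j M j * (nodal (u s) j.1 * nodal (v s) j.2))) => //.
  by move=> s sT; rewrite (BE (u s, v s))//; split; [exact: bu | exact: bv].
rewrite (BE (du, v t)); last by split; [|exact: bv].
rewrite (BE (u t, dv)); last by split; [exact: bu|].
rewrite -big_split/=; apply: has_slope_sum => j; rewrite -mulrDr.
by apply: has_slopeZ; exact: has_slopeM.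
Qed.

Lemma has_slope_bilinear_r (u : bfun cm) v (dv : bfun cm) t : t \in `[0, T] ->
  piecewise_bilinear u -> bilinear_in_time v -> piecewise_bilinear dv ->
  (forall j, has_slope T (fun s => nodal (v s) j) t (nodal dv j)) ->
  has_slope T (fun s => B u (v s)) t (B u dv).
Proof.
case: bB => M BE tT bu bv bdv sv.
apply: (@eq_has_slope _ _ (fun s => \sum_j M j * (nodal u j.1 * nodal (v s) j.2))) => //.
  by move=> s sT; rewrite (BE (u, v s))//; split; [|exact: bv].
rewrite (BE (u, dv))//; apply: has_slope_sum => j.
by do 2 apply: has_slopeZ.
Qed.

Lemma continuous_bilinear u v : bilinear_in_time u -> bilinear_in_time v ->
  (forall j, {within `[0, T], continuous (fun s => nodal (u s) j)}) ->
  (forall j, {within `[0, T], continuous (fun s => nodal (v s) j)}) ->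
  {within `[0, T], continuous (fun s => B (u s) (v s))}.
Proof.
case: bB => M BE bu bv cu cv.
apply: (@subspace_eq_continuous _ _ _
  (fun s => \sum_j M j * (nodal (u s) j.1 * nodal (v s) j.2))).
  move=> s /set_mem sT; apply/esym/(BE (u s, v s)).
  by split; [exact: bu | exact: bv].
elim: (index_enum _) => [|j r IH].
  rewrite (_ : (fun _ => _) = fun=> 0); first by move=> t; exact: cvg_cst.
  by apply/funext => s; rewrite big_nil.
rewrite (_ : (fun _ => _) = fun s => M j * (nodal (u s) j.1 * nodal (v s) j.2) +
  \sum_(i <- r) M i * (nodal (u s) i.1 * nodal (v s) i.2)).
  move=> t; apply: cvgD (IH t); apply: cvgM; first exact: cvg_cst.
  by apply: cvgM; [exact: cu | exact: cv].
by apply/funext => s; rewrite big_cons.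
Qed.

End BilinearInTime.

(* Testing the equation with xi at an arbitrary time s and differentiating in
   s at s = t amounts to testing it with the time derivative of xi. *)
Lemma wave_energy_estimate (B A : bfun cm -> bfun cm -> R)
    (xi eta : R -> bfun cm) :
  nodal_bilinear B -> nodal_bilinear A ->
  (forall y z, B y z = B z y) -> (forall y z, A y z = A z y) ->
  (forall y, 0 <= B y y) ->
  trajectory xi -> trajectory eta ->
  (forall t, t \in `[0, T] -> 0 <= A (xi t) (xi t)) ->
  (forall t s, t \in `[0, T] -> s \in `[0, T] ->
     B (dt T (dt T xi) t) (xi s) + A (xi t) (xi s) =
     B (dt T (dt T eta) t) (xi s)) ->
  let g t := Num.sqrt (B (dt T (dt T eta) t) (dt T (dt T eta) t)) in
  let E t := B (dt T xi t) (dt T xi t) + A (xi t) (xi t) in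
  {within `[0, T], continuous g} /\ forall t, t \in `[0, T] ->
  Num.sqrt (E t) <= Num.sqrt (E 0) +
    2 * \int[lebesgue_measure]_(s in `[0, T]) g s.
Proof.
move=> bB bA sB sA B0 txi teta A0 eqn g E.
have bxi0 := trajectory_bilinear0 txi; have bxi1 := trajectory_bilinear1 txi.
have bxi2 := trajectory_bilinear2 txi; have beta2 := trajectory_bilinear2 teta.
have eqn' t : t \in `[0, T] ->
    B (dt T (dt T xi) t) (dt T xi t) + A (xi t) (dt T xi t) =
    B (dt T (dt T eta) t) (dt T xi t).
  move=> tT.
  have slope (C : bfun cm -> bfun cm -> R) y : nodal_bilinear C ->
      piecewise_bilinear y ->
      has_slope T (fun s => C y (xi s)) t (C y (dt T xi t)).
    move=> bC yb; apply: (has_slope_bilinear_r bC) => //; first exact: bxi1.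
    by move=> j; exact: trajectory_slope1.
  apply: (has_slope_unique hT tT (f := fun s => B (dt T (dt T eta) t) (xi s))).
    apply: (eq_has_slope tT (f := fun s =>
      B (dt T (dt T xi) t) (xi s) + A (xi t) (xi s))).
      by move=> s sT; exact: eqn.
    by apply: has_slopeD; apply: slope => //; [exact: bxi2 | exact: bxi0].
  by apply: slope => //; exact: beta2.
pose dE t := 2 * B (dt T (dt T eta) t) (dt T xi t).
have Ed t : t \in `[0, T] -> has_slope T E t (dE t).
  move=> tT; have -> : dE t =
      (B (dt T (dt T xi) t) (dt T xi t) + B (dt T xi t) (dt T (dt T xi) t)) +
      (A (dt T xi t) (xi t) + A (xi t) (dt T xi t)).
    by rewrite /dE -eqn'// (sB (dt T xi t)) (sA (dt T xi t)); ring.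
  have s1 j := trajectory_slope1 txi (j := j) tT.
  have s2 j := trajectory_slope2 txi (j := j) tT.
  apply: has_slopeD.
    by apply: (has_slope_bilinear bB) => //; exact: bxi2.
  by apply: (has_slope_bilinear bA) => //; exact: bxi1.
have cg : {within `[0, T], continuous g}.
  have c := continuous_bilinear bB beta2 beta2
    (trajectory_continuous2 teta) (trajectory_continuous2 teta).
  by move=> t; apply: continuous_comp (c t) _; exact: sqrt_continuous.
split=> // t tT; apply: (energy_estimate hT Ed) => //.
- have c := continuous_bilinear bB beta2 bxi1
    (trajectory_continuous2 teta) (trajectory_continuous1 txi).
  by rewrite /dE => s; apply: cvgM; [exact: cvg_cst | exact: (c s)].
- by move=> s sT; rewrite addr_ge0 ?A0.
- by move=> s _; exact: sqrtr_ge0.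
- move=> s sT; rewrite /dE -mulrA ler_wpM2l//; apply: le_trans (ler_norm _) _.
  apply: le_trans (nodal_bilinear_CauchySchwarz bB sB _ (beta2 s sT) (bxi1 s sT)) _.
    by move=> u _; exact: B0.
  by rewrite ler_wpM2l ?sqrtr_ge0// ler_wsqrtr// lerDl A0.
Qed.

End Trajectories.

(** * Error bound *)

Lemma bilinearD {R : realType} (A : set (R * R)) (u v : R * R -> R) :
  bilinear_on A u -> bilinear_on A v -> bilinear_on A (fun x => u x + v x).
Proof.
move=> [c0 [c1 [c2 [c3 uE]]]] [d0 [d1 [d2 [d3 vE]]]].
exists (c0 + d0), (c1 + d1), (c2 + d2), (c3 + d3) => x Ax.
by rewrite uE// vE//; ring.
Qed.

Section MultiscaleSpace.
Context {R : realType} {fm : fine_mesh R} {cm : coarse_mesh fm}.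
Context (a : R * R -> R) (H : R) (sp : spectral cm).
Context (p m : 'I_(nblk cm) -> nat).
Implicit Types u v : bfun cm.

(** The bounds on [p] and [m] keep the indices in the range where [is_spectral] places the
    eigenfunctions in V_h(K). *)
Lemma in_VH_bilinear u : is_spectral a H sp ->
  (forall K, (p K <= n_bdry_nodes K)%N /\ (m K <= n_int_nodes K)%N) ->
  in_VH sp p m u -> piecewise_bilinear u.
Proof.
move=> spec pm Vu i; set K := blk cm i.
have [[bsys _ _ _ _] [isys _ _]] := spec K; have [pK mK] := pm K.
have [c [d uE]] := Vu K.
have bw : bilinear_on (crect i) (fun x => \sum_(j < p K) c j * sw sp K j x).
  apply: (@bilinear_sum _ _ _ _ _ _ (fun (j : 'I_(p K)) x => sw sp K j x)) => j _.
  have [[[_ bw] _] _] := bsys j (leq_trans (ltn_ord j) pK).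
  exact: bw.
have bz : bilinear_on (crect i) (fun x => \sum_(j < m K) d j * sz sp K j x).
  apply: (@bilinear_sum _ _ _ _ _ _ (fun (j : 'I_(m K)) x => sz sp K j x)) => j _.
  have [[[_ bz] _] _] := isys j (leq_trans (ltn_ord j) mK).
  exact: bz.
have [c0 [c1 [c2 [c3 E]]]] := bilinearD bw bz.
by exists c0, c1, c2, c3 => x ix; rewrite uE ?E//; exists i.
Qed.

Lemma in_VHB u v : in_VH sp p m u -> in_VH sp p m v ->
  in_VH sp p m (fun K x => u K x - v K x).
Proof.
move=> Vu Vv K; have [c [d uE]] := Vu K; have [c' [d' vE]] := Vv K.
exists (fun i => c i - c' i), (fun j => d j - d' j) => x Kx.
rewrite uE// vE// opprD addrACA -!sumrB.
by congr (_ + _); apply: eq_bigr => j _; rewrite mulrBl.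
Qed.

End MultiscaleSpace.

Lemma fine_size_gt0 {R : realType} (fm : fine_mesh R) Omega h :
  is_fine_mesh fm Omega -> fine_size fm h -> 0 < h.
Proof.
move=> [nondeg _ _ _] [_ [i [s <-]]].
by rewrite subr_gt0; exact: side_lo_lt_hi.
Qed.

Section ErrorBound.
Context {R : realType} {fm : fine_mesh R} {cm : coarse_mesh fm}.
Context (Omega : set (R * R)) (a : R * R -> R) (a0 a1 h gamma T : R).
Context (meshP : is_fine_mesh fm Omega) (ha : coefficient Omega a a0 a1).
Context (a0_gt0 : 0 < a0) (a1_gt0 : 0 < a1) (gh : 0 <= gamma / h) (hT : 0 < T).

Let nondeg (i : 'I_(nrect fm)) :
  (lowc i).1 < (uppc i).1 /\ (lowc i).2 < (uppc i).2.
Proof. by case: meshP. Qed.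

(** The squared norms compare with factor [a1], and a1 <= (1 + a1)^2; this also covers a1 < 1. Only
    piecewise bilinearity is asked, so the bound is available for eta. *)
Lemma norm_a_le_norm_H1 (u : bfun cm) : piecewise_bilinear u ->
  norm_a Omega a h gamma u <= (1 + a1) * norm_H1 Omega h gamma u.
Proof.
move=> bu; rewrite norm_aE norm_H1E.
have c1 : coefficient Omega (cst 1) 1 1.
  by split=> [|x _]; [exact: measurable_cst | rewrite /= lexx].
have f0 := broken_form_ge0 meshP c1 ler01 u gh.
have c0 : 0 <= 1 + a1 by rewrite addr_ge0// ltW.
have -> : 1 + a1 = Num.sqrt ((1 + a1) ^+ 2) by rewrite sqrtr_sqr ger0_norm.
rewrite -sqrtrM ?sqr_ge0//; apply: ler_wsqrtr.
apply: le_trans (le_broken_form meshP ha gh bu) _.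
by rewrite ler_wpM2r// expr2; nra.
Qed.

Lemma norm_L2_trajectoryB (u v : R -> bfun cm) t :
  trajectory T u -> trajectory T v -> t \in `[0, T] ->
  norm_L2 (dt T (fun t K x => u t K x - v t K x) t) <=
  norm_L2 (dt T u t) + norm_L2 (dt T v t).
Proof.
move=> tu tv tT; apply: (nodal_bilinear_triangle (nodal_bilinear_ip meshP)).
- exact: ipC.
- by move=> w _; exact: ip_ge0.
- exact: (trajectory_bilinear1 nondeg hT tu tT).
- exact: (trajectory_bilinear1 nondeg hT tv tT).
- exact: (trajectory_bilinear1 nondeg hT (trajectoryB hT tu tv) tT).
- by move=> j; rewrite (nodal_dt_trajectoryB nondeg hT tu tv).
Qed.

Lemma norm_a_B (u v : bfun cm) : piecewise_bilinear u -> piecewise_bilinear v ->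
  norm_a Omega a h gamma (fun K x => u K x - v K x) <=
  norm_a Omega a h gamma u + norm_a Omega a h gamma v.
Proof.
move=> bu bv; rewrite !norm_aE.
apply: (nodal_bilinear_triangle (nodal_bilinear_broken_form meshP ha h gamma)) => //.
- exact: broken_formC.
- by move=> w _; exact: (broken_form_ge0 meshP ha (ltW a0_gt0) w gh).
- exact: piecewise_bilinearB.
Qed.

Lemma multiscale_energy_estimate (eta xi : R -> bfun cm) :
  trajectory T eta -> trajectory T xi ->
  (forall t, t \in `[0, T] ->
    1 / 2 * norm_a Omega a h gamma (xi t) ^+ 2 <= aDG Omega a h gamma (xi t) (xi t) /\
    aDG Omega a h gamma (xi t) (xi t) <=
      2 * norm_a Omega a h gamma (xi t) * norm_a Omega a h gamma (xi t)) ->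
  (forall t s, t \in `[0, T] -> s \in `[0, T] ->
     ip (dt T (dt T xi) t) (xi s) + aDG Omega a h gamma (xi t) (xi s) =
     ip (dt T (dt T eta) t) (xi s)) ->
  exists L : R, [/\ norm_L1 T (@norm_L2 R fm cm) (dt T (dt T eta)) = L%:E, 0 <= L &
    forall t, t \in `[0, T] ->
      let Q := norm_L2 (dt T xi 0) +
        2 * (1 + a1) * norm_H1 Omega h gamma (xi 0) + 2 * L in
      norm_L2 (dt T xi t) <= Q /\ norm_a Omega a h gamma (xi t) <= 2 * Q].
Proof.
move=> teta txi pen eqn.
have zT : 0 \in `[0, T] by rewrite in_itv/= lexx ltW.
have na0 (u : bfun cm) : 0 <= norm_a Omega a h gamma u by exact: sqrtr_ge0.
have A0 t : t \in `[0, T] -> 0 <= aDG Omega a h gamma (xi t) (xi t).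
  move=> tT; have [p _] := pen t tT; apply: le_trans p.
  by rewrite mulr_ge0 ?sqr_ge0.
have [cg est] := wave_energy_estimate nondeg hT (nodal_bilinear_ip meshP)
  (nodal_bilinear_aDG meshP ha h gamma) (@ipC _ _ _) (aDGC Omega a h gamma)
  (@ip_ge0 _ _ _) txi teta A0 eqn.
pose L := \int[lebesgue_measure]_(s in `[0, T])
  norm_L2 (dt T (dt T eta) s).
pose E t := ip (dt T xi t) (dt T xi t) + aDG Omega a h gamma (xi t) (xi t).
have {}est t : t \in `[0, T] -> Num.sqrt (E t) <= Num.sqrt (E 0) + 2 * L.
  exact: est.
have L0 : 0 <= L by apply: Rintegral_ge0 => s _; exact: sqrtr_ge0.
exists L; split=> // [|t tT Q].
  (* The extended-real L^1 norm is finite because its integrand is continuous on [[0, T]]. *)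
  rewrite /norm_L1 /L /Rintegral fineK//; apply: integrable_fin_num => //.
  by apply: continuous_compact_integrable => //; exact: segment_compact.
have EQ : Num.sqrt (E t) <= Q.
  apply: le_trans (est t tT) _; rewrite lerD2r.
  set n := norm_L2 _; set N := norm_H1 _ _ _ _.
  have n0 : 0 <= n by exact: sqrtr_ge0.
  have N0 : 0 <= N by exact: sqrtr_ge0.
  have NA := norm_a_le_norm_H1 (trajectory_bilinear0 txi zT).
  have c0 : 0 <= n + 2 * (1 + a1) * N.
    by rewrite addr_ge0// mulr_ge0// mulr_ge0// addr_ge0// ltW.
  rewrite -[leRHS]ger0_norm// -sqrtr_sqr ler_wsqrtr//.
  (* With k = (1 + a1) N: E 0 <= n^2 + 2 M^2 <= n^2 + 2 k^2 <= (n + 2 k)^2, which is the origin of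
     the first two terms of [Q]. *)
  have [_ p0] := pen 0 zT.
  have n2 : ip (dt T xi 0) (dt T xi 0) = n ^+ 2 by rewrite sqr_sqrtr// ip_ge0.
  rewrite /E n2; move: p0 NA (na0 (xi 0)); set A := aDG _ _ _ _ _ _; rewrite -/N.
  set M := norm_a _ _ _ _ _; set c := (1 + a1) => p0 NA M0.
  have cN : 0 <= c * N by rewrite (le_trans M0).
  rewrite -mulrA; move: (c * N) NA cN => k Mk k0.
  have : M * M <= k * k by rewrite ler_pM.
  have : 0 <= n * k by rewrite mulr_ge0.
  by rewrite !expr2; nra.
have E0 : 0 <= E t by rewrite /E addr_ge0 ?ip_ge0 ?A0.
have nE : norm_L2 (dt T xi t) <= Num.sqrt (E t).
  by rewrite ler_wsqrtr// /E lerDl A0.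
split; first exact: le_trans nE EQ.
(* Coercivity bounds the squared energy norm by 2 E, hence by 4 E, and 2 is rewritten as the square
   root of 2^2. *)
apply: le_trans (ler_wpM2l _ EQ) => //.
rewrite -[leLHS]ger0_norm// -sqrtr_sqr -[2]ger0_norm// -[`|2|]sqrtr_sqr.
rewrite -sqrtrM ?sqr_ge0//.
rewrite ler_wsqrtr//; have [p _] := pen t tT.
have := ip_ge0 (dt T xi t); rewrite /E; set A := aDG _ _ _ _ _ _ in p *.
by move: (A0 t tT); rewrite -/A => ? ?; lra.
Qed.

End ErrorBound.

Lemma norm_Linf_ub {R : realType} {fm : fine_mesh R} {cm : coarse_mesh fm}
    (T : R) (N : bfun cm -> R) (u : R -> bfun cm) t :
  t \in `[0, T] -> ((N (u t))%:E <= norm_Linf T N u)%E.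
Proof. by move=> tT; apply: ereal_sup_ubound; exists t. Qed.

Unset Implicit Arguments.

Theorem theorem1 (R : realType) (Omega : set (R * R)) (a : R * R -> R)
    (a0 a1 T : R)
    (hOmega : is_domain Omega) (ha0 : 0 < a0) (ha1 : 0 < a1)
    (ha : coefficient Omega a a0 a1) (hT : 0 < T) :
  exists C : R, 0 < C /\
  forall (fm : fine_mesh R) (cm : coarse_mesh fm) (h H gamma : R)
    (sp : spectral cm) (p m : 'I_(nblk cm) -> nat)
    (f : R -> R * R -> R) (g0 g1 : R * R -> R)
    (uh : R -> R * R -> R) (uH wH : R -> bfun cm),
  is_fine_mesh fm Omega -> fine_size fm h ->
  is_coarse_mesh cm -> coarse_size cm H ->
  is_spectral a H sp ->
  (forall K, (p K <= n_bdry_nodes K)%N /\ (m K <= n_int_nodes K)%N) ->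
  0 < gamma -> penalty_large Omega a h gamma sp p m ->
  (forall t, t \in `[0, T] -> in_L2 Omega (f t)) ->
  in_L2 Omega g0 -> in_L2 Omega g1 ->
  time_C2 T (fun t => brk cm (uh t)) -> time_C2 T uH -> time_C2 T wH ->
  is_fine_solution cm Omega a T f uh ->
  is_IPDG_solution Omega a h gamma T sp p m f g0 g1 uH ->
  is_elliptic_proj Omega a h gamma T sp p m f uh wH ->
  let eta : R -> bfun cm := fun t K x => uh t x - wH t K x in
  let xi : R -> bfun cm := fun t K x => uH t K x - wH t K x in
  let eps : R -> bfun cm := fun t K x => uh t x - uH t K x in
  let I1 : R := norm_L2 (dt T xi 0) + norm_H1 Omega h gamma (xi 0) in
  (norm_Linf T (@norm_L2 R fm cm) (dt T eps)
   + norm_Linf T (norm_a Omega a h gamma) eps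
   <= C%:E * (norm_Linf T (@norm_L2 R fm cm) (dt T eta)
              + norm_Linf T (norm_H1 Omega h gamma) eta
              + norm_L1 T (@norm_L2 R fm cm) (dt T (dt T eta))
              + I1%:E))%E.
Proof.
(* The two bounds add up to SA + (1 + a1) SB + 3 Q, where 3 Q = 3 n + 6 (1 + a1) N + 6 L; the
   constant dominates each coefficient. *)
exists (6 * (1 + a1)); split; first by rewrite mulr_gt0// addr_gt0.
move=> fm cm h H gamma sp p m f g0 g1 uh uH wH meshP hP _ _ spec pm gamma0.
move=> [coer cont] _ _ _ C2h C2H C2w fineP [solP _ _] ellP.
pose eta : R -> bfun cm := fun t K x => uh t x - wH t K x.
pose xi : R -> bfun cm := fun t K x => uH t K x - wH t K x.
pose eps : R -> bfun cm := fun t K x => uh t x - uH t K x.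
pose I1 := norm_L2 (dt T xi 0) + norm_H1 Omega h gamma (xi 0).
suff : (norm_Linf T (@norm_L2 R fm cm) (dt T eps)
  + norm_Linf T (norm_a Omega a h gamma) eps
  <= (6 * (1 + a1))%:E * (norm_Linf T (@norm_L2 R fm cm) (dt T eta)
    + norm_Linf T (norm_H1 Omega h gamma) eta
    + norm_L1 T (@norm_L2 R fm cm) (dt T (dt T eta)) + I1%:E))%E by [].
have gh : 0 <= gamma / h by rewrite ltW// divr_gt0//; exact: fine_size_gt0 meshP hP.
have nondeg (i : 'I_(nrect fm)) :
    (lowc i).1 < (uppc i).1 /\ (lowc i).2 < (uppc i).2 by case: meshP.
have th : trajectory T (fun t => brk cm (uh t)).
  by split=> // t /fineP[[_ bil _] _] i; exact: bil.
have VH t : t \in `[0, T] -> in_VH sp p m (uH t) by move=> /solP[].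
have Vw t : t \in `[0, T] -> in_VH sp p m (wH t) by move=> /ellP[].
have tH : trajectory T uH.
  by split=> // t /VH Vt; exact: in_VH_bilinear spec pm Vt.
have tw : trajectory T wH.
  by split=> // t /Vw Vt; exact: in_VH_bilinear spec pm Vt.
have teta : trajectory T eta := trajectoryB hT th tw.
have txi : trajectory T xi := trajectoryB hT tH tw.
have Vxi t : t \in `[0, T] -> in_VH sp p m (xi t).
  by move=> tT; exact: in_VHB (VH t tT) (Vw t tT).
have eqn t s : t \in `[0, T] -> s \in `[0, T] ->
    ip (dt T (dt T xi) t) (xi s) + aDG Omega a h gamma (xi t) (xi s) =
    ip (dt T (dt T eta) t) (xi s).
  move=> tT sT; have bs := trajectory_bilinear0 txi sT.
  have subl (B : bfun cm -> bfun cm -> R) u v z : nodal_bilinear B ->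
      piecewise_bilinear u -> piecewise_bilinear v -> piecewise_bilinear z ->
      (forall j, nodal z j = nodal u j - nodal v j) ->
      B z (xi s) = B u (xi s) - B v (xi s).
    move=> bB bu bv bz zE; rewrite (nodal_bilinear_combl bB (k := -1) bu bv bz bs).
      by rewrite mulN1r.
    by move=> j; rewrite zE mulN1r.
  have bip := nodal_bilinear_ip (cm := cm) meshP.
  have b2h := trajectory_bilinear2 nondeg hT th tT.
  have b2w := trajectory_bilinear2 nondeg hT tw tT.
  have b2H := trajectory_bilinear2 nondeg hT tH tT.
  rewrite (subl _ _ _ _ bip b2H b2w (trajectory_bilinear2 nondeg hT txi tT));
    last by move=> j; exact: (nodal_dt2_trajectoryB nondeg hT tH tw).
  rewrite (subl _ _ _ _ bip b2h b2w (trajectory_bilinear2 nondeg hT teta tT));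
    last by move=> j; exact: (nodal_dt2_trajectoryB nondeg hT th tw).
  rewrite (subl _ _ _ _ (nodal_bilinear_aDG (cm := cm) meshP ha h gamma)
    (trajectory_bilinear0 tH tT) (trajectory_bilinear0 tw tT)
    (trajectory_bilinear0 txi tT))//.
  have [_ /(_ _ (Vxi s sT)) eH] := solP t tT.
  have [_ /(_ _ (Vxi s sT)) ew] := ellP t tT.
  rewrite /consistency_error in ew.
  (* In the equation of the projection a_DG(u_h, v) cancels, leaving a_DG(w_H, v) = (f, v) - (u_h'',
     v); subtracting this from the multiscale equation removes f. *)
  have alg (x y z w r k l : R) : x + z = k -> w = l + (k - r - l) ->
      x - y + (z - w) = r - y by move=> <- ->; ring.
  exact: alg eH ew.
have pen t : t \in `[0, T] ->
    1 / 2 * norm_a Omega a h gamma (xi t) ^+ 2 <= aDG Omega a h gamma (xi t) (xi t) /\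
    aDG Omega a h gamma (xi t) (xi t) <=
      2 * norm_a Omega a h gamma (xi t) * norm_a Omega a h gamma (xi t).
  by move=> /Vxi Vt; split; [exact: coer | exact: cont].
have [L [-> L0 bound]] :=
  multiscale_energy_estimate meshP ha ha1 gh hT teta txi pen eqn.
set Q := norm_L2 (dt T xi 0) + 2 * (1 + a1) * norm_H1 Omega h gamma (xi 0) + 2 * L.
have epsE : eps = fun t K x => eta t K x - xi t K x.
  by apply/funext => t; apply/funext => K; apply/funext => x;
    rewrite /eps /eta /xi; ring.
have zT : 0 \in `[0, T] by rewrite in_itv/= lexx ltW.
set SA := norm_Linf T (@norm_L2 R fm cm) (dt T eta).
set SB := norm_Linf T (norm_H1 Omega h gamma) eta.
have leA : (norm_Linf T (@norm_L2 R fm cm) (dt T eps) <= SA + Q%:E)%E.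
  apply: ub_ereal_sup => _ [t tT <-]; rewrite epsE.
  apply: (@le_trans _ _ (norm_L2 (dt T eta t) + Q)%:E).
    rewrite lee_fin; apply: le_trans (norm_L2_trajectoryB meshP hT teta txi tT) _.
    by rewrite lerD2l; have [] := bound t tT.
  by rewrite EFinD leeD2r//; exact: (norm_Linf_ub (@norm_L2 R fm cm)).
have leB : (norm_Linf T (norm_a Omega a h gamma) eps <=
    (1 + a1)%:E * SB + (2 * Q)%:E)%E.
  apply: ub_ereal_sup => _ [t tT <-]; rewrite epsE.
  apply: (@le_trans _ _ ((1 + a1) * norm_H1 Omega h gamma (eta t) + 2 * Q)%:E).
    rewrite lee_fin; apply: le_trans (norm_a_B meshP ha ha0 gh
      (trajectory_bilinear0 teta tT) (trajectory_bilinear0 txi tT)) _.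
    rewrite lerD//; last by have [] := bound t tT.
    exact: norm_a_le_norm_H1 meshP ha ha1 gh _ (trajectory_bilinear0 teta tT).
  rewrite EFinD EFinM leeD2r//; apply: lee_wpmul2l.
    by rewrite lee_fin addr_ge0// ltW.
  exact: (norm_Linf_ub (norm_H1 Omega h gamma) eta tT).
apply: le_trans (leeD leA leB) _.
have SA0 : (0 <= SA)%E.
  apply: le_trans (norm_Linf_ub (@norm_L2 R fm cm) (dt T eta) zT).
  by rewrite lee_fin sqrtr_ge0.
have SB0 : (0 <= SB)%E.
  apply: le_trans (norm_Linf_ub (norm_H1 Omega h gamma) eta zT).
  by rewrite lee_fin sqrtr_ge0.
have n0 : 0 <= norm_L2 (dt T xi 0) by exact: sqrtr_ge0.
have N0 : 0 <= norm_H1 Omega h gamma (xi 0) by exact: sqrtr_ge0.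
have c0 : (0 < (6 * (1 + a1))%:E)%E by rewrite lte_fin mulr_gt0// addr_gt0.
(* The suprema of eta are extended reals. If one is infinite, the right-hand side is +oo; otherwise
   a linear inequality between reals remains. *)
have toy (x : \bar R) : (x = +oo -> SA + Q%:E + ((1 + a1)%:E * SB + (2 * Q)%:E) <=
    (6 * (1 + a1))%:E * x)%E by move=> ->; rewrite gt0_muley// leey.
case: (SA) (SB) SA0 SB0 toy => [A| |] [B| |]//= A0 B0 toy; try exact: toy.
rewrite !lee_fin in A0 B0.
rewrite -?EFinM -!EFinD -?EFinM lee_fin /I1 /Q.
move: n0 N0; set n := norm_L2 _; set N := norm_H1 _ _ _ _ => n0 N0.
have : 0 <= a1 * A /\ 0 <= a1 * B /\ 0 <= a1 * L /\ 0 <= a1 * n /\ 0 <= a1 * N.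
  by have a1_ge0 := ltW ha1; rewrite !mulr_ge0.
by move=> [? [? [? [? ?]]]]; lra.
Qed.
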